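(* Let $r,s,t>0$ be real numbers and let $K_r$ and $K_{s,t}$ be the positive definite kernels on the open unit disc $\mathbb D$ given by $$K_r(z,w)=\sum_{k=0}^\infty \frac{k+r}{r}(z\bar w)^k,\qquad K_{s,t}(z,w)=\sum_{k=0}^\infty \frac{(k+s)(k+t)}{st}(z\bar w)^k\qquad (z,w\in\mathbb D).$$ Then the multiplication operator $M_z$ on $\mathcal H(K_r+K_{s,t})$ is subnormal if and only if $$(rs+st+tr)^2\geq 8r^2st.$$
   Context: $\mathbb D=\{z\in\mathbb C:|z|<1\}$. For a positive definite kernel $K$ on $\mathbb D$ (holomorphic in the first variable and anti-holomorphic in the second), $\mathcal H(K)$ denotes the reproducing kernel Hilbert space of holomorphic functions on $\mathbb D$ with reproducing kernel $K$, and $M_z$ denotes the operator of multiplication by the coordinate function, $(M_zf)(z)=zf(z)$. A bounded operator $T$ on a Hilbert space $\mathcal H$ is subnormal if there are a Hilbert space $\mathcal K\supset\mathcal H$ and a bounded normal operator $N$ on $\mathcal K$ with $N(\mathcal H)\subset\mathcal H$ and $N|_{\mathcal H}=T$. *)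

(* Defs.v *)
From HB Require Import structures.
From mathcomp Require Import all_boot all_order all_algebra complex.
From mathcomp Require Import all_classical all_reals all_analysis.

Set Implicit Arguments.
Unset Strict Implicit.
Unset Printing Implicit Defensive.

Import Order.TTheory GRing.Theory Num.Theory.
Import numFieldNormedType.Exports.

Local Open Scope classical_set_scope.
Local Open Scope ring_scope.

(* The structure type is kept in the definition (instead of using R[i]
   directly) so that the topology MathComp-Analysis puts on every
   numClosedFieldType is inferred on complex numbers. *)
Definition Cplx (R : realType) : numClosedFieldType := R[i].

(* The inner product is linear in its first argument and conjugate-linear in
   its second one. *)
Definition inner_product (R : realType) (V : lmodType (Cplx R)) :=
  {dot V for @Num.conj (Cplx R)}.

Definition dot_norm (R : realType) (V : lmodType (Cplx R))
    (dot : inner_product V) (x : V) : R :=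
  Num.sqrt (complex.Re (dot x x)).

Definition dot_complete (R : realType) (V : lmodType (Cplx R))
    (dot : inner_product V) : Prop :=
  forall u : nat -> V,
    (forall e : R, 0 < e ->
       exists N : nat, forall m n : nat, (N <= m)%N -> (N <= n)%N ->
         dot_norm dot (u m - u n) < e) ->
    exists l : V, forall e : R, 0 < e ->
      exists N : nat, forall n : nat, (N <= n)%N -> dot_norm dot (u n - l) < e.

Record hilbert (R : realType) := Hilbert {
  hcarrier :> lmodType (Cplx R);
  hdot : inner_product hcarrier;
  hcomplete : dot_complete hdot }.

Definition hnorm (R : realType) (H : hilbert R) (x : H) : R :=
  dot_norm (hdot H) x.

Definition bounded_op (R : realType) (H : hilbert R) (T : {linear H -> H}) :
    Prop :=
  exists M : R, forall x : H, hnorm (T x) <= M * hnorm x.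

Definition is_adjoint (R : realType) (H : hilbert R) (T S : {linear H -> H}) :
    Prop :=
  forall x y : H, hdot H (T x) y = hdot H x (S y).

Definition normal_op (R : realType) (H : hilbert R) (N : {linear H -> H}) :
    Prop :=
  exists N' : {linear H -> H},
    is_adjoint N N' /\ forall x : H, N (N' x) = N' (N x).

(* The inclusion of H in the larger space K is the linear isometry j. *)
Definition subnormal (R : realType) (H : hilbert R) (T : {linear H -> H}) :
    Prop :=
  bounded_op T /\
  exists (K : hilbert R) (j : {linear H -> K}) (N : {linear K -> K}),
    [/\ forall x y : H, hdot K (j x) (j y) = hdot H x y,
        bounded_op N,
        normal_op N
      & forall x : H, N (j x) = j (T x)].

Definition disc (R : realType) : Type := {z : Cplx R | `|z| < 1}.

(* A Hilbert space of functions on the disc with reproducing kernel K.  Its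
   elements are identified with functions through the injective linear map
   feval.  Given K, such a space is unique up to a unitary map commuting with
   feval; holomorphy of its elements follows from that of the kernel sections. *)
Record rkhs (R : realType) (K : disc R -> disc R -> Cplx R) := RKHS {
  rkhs_space :> hilbert R;
  feval : {linear rkhs_space -> (disc R -> (Cplx R)^o)};
  feval_inj : injective feval;
  ksection : disc R -> rkhs_space;
  ksectionE : forall w z : disc R, feval (ksection w) z = K z w;
  reproducing : forall (f : rkhs_space) (w : disc R),
    feval f w = hdot rkhs_space f (ksection w) }.

Definition is_mulz (R : realType) (K : disc R -> disc R -> Cplx R)
    (H : rkhs K) (T : {linear H -> H}) : Prop :=
  forall (f : H) (z : disc R), feval H (T f) z = val z * feval H f z.

(* Multiplication by z maps H into H and is subnormal there; the operator T is
   determined by is_mulz since feval is injective. *)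
Definition Mz_subnormal (R : realType) (K : disc R -> disc R -> Cplx R)
    (H : rkhs K) : Prop :=
  exists T : {linear H -> H}, is_mulz T /\ subnormal T.

(* The kernel  sum_k a_k (z w^* )^k. *)
Definition diag_kernel (R : realType) (a : nat -> R) (z w : disc R) : Cplx R :=
  limn (series (fun k : nat => (a k)%:C%C * (val z * (val w)^*) ^+ k :> Cplx R)).

Definition kernel1 (R : realType) (r : R) : disc R -> disc R -> Cplx R :=
  diag_kernel (fun k : nat => (k%:R + r) / r).

Definition kernel2 (R : realType) (s t : R) : disc R -> disc R -> Cplx R :=
  diag_kernel (fun k : nat => (k%:R + s) * (k%:R + t) / (s * t)).

(* Main.v *)
Require Import Defs.
From HB Require Import structures.
From mathcomp Require Import all_boot all_order all_algebra complex.
From mathcomp Require Import all_classical all_reals all_analysis.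
From mathcomp Require Import ring lra zify.
Import Order.TTheory GRing.Theory Num.Theory.
Import numFieldNormedType.Exports.
Set Implicit Arguments.
Unset Strict Implicit.
Unset Printing Implicit Defensive.
Local Open Scope classical_set_scope.
Local Open Scope ring_scope.

(** The kernel is the power series in z conj(w) with coefficients
    a_k = (k^2 + b k + 2st) / (st), where b = (rs + st + tr) / r. Hence the
    monomials are orthogonal, z^k has squared norm 1/a_k, and multiplication by z
    is a weighted shift. Such a shift is subnormal exactly when 1/a_k is a moment
    sequence of a positive measure on [0,1], and the inequality says that the
    quadratic polynomial st a_k has real roots.

    If the roots -alpha and -beta are real, they are negative and
    1/a_k = st / ((k+alpha)(k+beta)) is a product of two moment sequences. The
    sequence 1/(k+b) is that of the measure x^(b-1) dx. Instead of this measure,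
    the proof uses multiplication by x written as a Jacobi matrix in the basis of
    orthogonal polynomials (jac_h_step): a bounded self-adjoint operator on
    square-summable sequences whose moments are checked by algebra. The tensor
    product of two such operators has the product of the moments
    (product_moments), and its product with a bilateral shift is a normal operator
    that extends multiplication by z (subnormal_of_moments).

    If the roots -u + iv and -u - iv are not real, 1/a_k is proportional to the
    imaginary part of 1/(k + u - iv). For a normal operator N the differences of
    even order of the sequence |N^k x|^2 are squared norms, hence nonnegative
    (fdiff_ge0_normal). The n-th difference of 1/(k+w) at 0 is
    n! / (w (w+1) ... (w+n)). With w = u - iv the argument of the denominator
    decreases without bound in shrinking steps, because the harmonic series
    diverges, so the imaginary part is negative for some even n
    (argument_turns).

    The space is only given abstractly, so the monomials must first be found in
    it: z^i is the limit of rescaled kernel sections from which the lower monomials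
    are removed (next_monomial). Completeness then yields the expansion of every
    element and the boundedness of multiplication by z (mulz_exists). *)

(** * Limits of real sequences *)

Section RealSequences.
Variable R : realType.
Implicit Types (f g : nat -> R) (l m : R).

Lemma seq_cvg_eq f g l m :
  g @ \oo --> m -> f =1 g -> m = l -> f @ \oo --> l.
Proof. by move=> gm /funext -> <-. Qed.
Lemma seqD f g l m : f @ \oo --> l -> g @ \oo --> m ->
  (fun n => f n + g n) @ \oo --> l + m.
Proof. by move=> h1 h2; exact: cvgD. Qed.
Lemma seqB f g l m : f @ \oo --> l -> g @ \oo --> m ->
  (fun n => f n - g n) @ \oo --> l - m.
Proof. by move=> h1 h2; exact: cvgB. Qed.
Lemma seqM f g l m : f @ \oo --> l -> g @ \oo --> m ->
  (fun n => f n * g n) @ \oo --> l * m.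
Proof. by move=> h1 h2; exact: cvgM. Qed.
Lemma seqZ c f l : f @ \oo --> l -> (fun n => c * f n) @ \oo --> c * l.
Proof. by move=> h; apply: seqM => //; exact: cvg_cst. Qed.
Lemma seq_uniq f l m : f @ \oo --> l -> f @ \oo --> m -> l = m.
Proof. by move=> h1 h2; apply: (cvg_unique _ h1 h2). Qed.
Lemma seq_le f g l m : f @ \oo --> l -> g @ \oo --> m ->
  (forall n, f n <= g n) -> l <= m.
Proof.
by move=> h1 h2 fg; apply: (ler_cvg_to h1 h2); apply: nearW => n; exact: fg.
Qed.
Lemma seq_shift f l k : f @ \oo --> l -> (fun n => f (n + k)%N) @ \oo --> l.
Proof. by move=> h; rewrite cvg_shiftn. Qed.
Lemma seqS f l : f @ \oo --> l -> (fun n => f n.+1) @ \oo --> l.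
Proof. by move=> h; rewrite cvg_shiftS. Qed.

Lemma seq_double f l :
  f @ \oo --> l -> (fun n => f n.*2) @ \oo --> l.
Proof.
move=> h; apply/cvgrPdist_lt => e e0.
have /cvgrPdist_lt /(_ _ e0) [N _ hN] := h; exists N => // n /= Nn.
by apply: hN => /=; apply: leq_trans Nn _; rewrite -addnn leq_addr.
Qed.

Lemma squeeze0 (f g : nat -> R) : (forall n, 0 <= f n <= g n) ->
  g @ \oo --> (0 : R) -> f @ \oo --> (0 : R).
Proof.
move=> fg g0; apply: (squeeze_cvgr _ (cvg_cst 0) g0).
by apply: nearW => n; exact: fg.
Qed.

Lemma cvgr0_sqr (f : nat -> R) :
  (fun n => f n ^+ 2) @ \oo --> (0 : R) -> f @ \oo --> (0 : R).
Proof.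
move=> h; apply/cvgrPdist_lt => e e0.
have /cvgrPdist_lt /(_ (e ^+ 2)) := h; rewrite exprn_gt0 // => /(_ isT).
apply: filterS => n; rewrite !sub0r !normrN normrX ltr_sqr ?nnegrE //.
exact: ltW.
Qed.

Lemma nondecr_bounded_cvg f M : (forall n, f n <= f n.+1) ->
  (forall n, f n <= M) -> exists2 l, f @ \oo --> l & forall n, f n <= l.
Proof.
move=> fS fM.
have nd : nondecreasing_seq f by apply/nondecreasing_seqP.
have ub : has_ubound (range f) by exists M => _ [n _ <-].
exists (limn f); first exact: nondecreasing_is_cvgn.
by move=> n; apply: nondecreasing_cvgn_le => //; exact: nondecreasing_is_cvgn.
Qed.

Lemma seq_cauchy (f : nat -> R) l : f @ \oo --> l ->
  forall e : R, 0 < e -> exists N, forall i j, (N <= i)%N -> (N <= j)%N ->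
    `|f i - f j| < e.
Proof.
move=> /cvgrPdist_lt h e e0; have [|N _ hN] := h (e / 2); first by rewrite divr_gt0.
exists N => i j Ni Nj; have := hN i Ni; have := hN j Nj.
rewrite /= => h1 h2; rewrite -(subrKA l) (le_lt_trans (ler_normD _ _)) //.
rewrite (distrC (f i)); lra.
Qed.
End RealSequences.

(** * Real and imaginary parts *)

Section ComplexParts.
Variable R : realType.
Implicit Types (x y : Cplx R) (c : R).

Lemma ReD x y : complex.Re (x + y) = complex.Re x + complex.Re y.
Proof. by case: x => a b; case: y => c d. Qed.
Lemma ImD x y : complex.Im (x + y) = complex.Im x + complex.Im y.
Proof. by case: x => a b; case: y => c d. Qed.
Lemma ReN x : complex.Re (- x) = - complex.Re x.
Proof. by case: x. Qed.
Lemma ImN x : complex.Im (- x) = - complex.Im x.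
Proof. by case: x. Qed.
Lemma ReM x y : complex.Re (x * y) =
  complex.Re x * complex.Re y - complex.Im x * complex.Im y.
Proof. by case: x => a b; case: y => c d. Qed.
Lemma ImM x y : complex.Im (x * y) =
  complex.Re x * complex.Im y + complex.Im x * complex.Re y.
Proof. by case: x => a b; case: y => c d. Qed.
Lemma ReJ x : complex.Re (x^* : Cplx R) = complex.Re x.
Proof. by case: x. Qed.
Lemma ImJ x : complex.Im (x^* : Cplx R) = - complex.Im x.
Proof. by case: x. Qed.
Lemma Re0 : complex.Re (0 : Cplx R) = 0. Proof. by []. Qed.
Lemma Im0 : complex.Im (0 : Cplx R) = 0. Proof. by []. Qed.
Lemma Re1 : complex.Re (1 : Cplx R) = 1. Proof. by []. Qed.
Lemma Im1 : complex.Im (1 : Cplx R) = 0. Proof. by []. Qed.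
Lemma ReC c : complex.Re (c%:C%C : Cplx R) = c. Proof. by []. Qed.
Lemma ImC c : complex.Im (c%:C%C : Cplx R) = 0. Proof. by []. Qed.
Definition partE := (ReD, ImD, ReN, ImN, ReM, ImM, ReJ, ImJ, Re0, Im0, Re1,
  Im1, ReC, ImC).

Lemma Cplx_eq x y : complex.Re x = complex.Re y ->
  complex.Im x = complex.Im y -> x = y.
Proof. by case: x => a b; case: y => c d /= -> ->. Qed.

Lemma Re_sum I (r : seq I) (P : pred I) (F : I -> Cplx R) :
  complex.Re (\sum_(i <- r | P i) F i) = \sum_(i <- r | P i) complex.Re (F i).
Proof. by elim/big_rec2: _ => // i a b _ <-; rewrite ReD. Qed.
Lemma Im_sum I (r : seq I) (P : pred I) (F : I -> Cplx R) :
  complex.Im (\sum_(i <- r | P i) F i) = \sum_(i <- r | P i) complex.Im (F i).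
Proof. by elim/big_rec2: _ => // i a b _ <-; rewrite ImD. Qed.

Lemma rcD (a b : R) : ((a + b)%:C = a%:C + b%:C :> Cplx R)%C.
Proof. by apply: Cplx_eq; rewrite !partE ?addr0. Qed.
Lemma rcM (a b : R) : ((a * b)%:C = a%:C * b%:C :> Cplx R)%C.
Proof. by apply: Cplx_eq; rewrite !partE ?mulr0 ?mul0r ?subr0 ?addr0. Qed.
Lemma rcX (a : R) n : ((a ^+ n)%:C = a%:C ^+ n :> Cplx R)%C.
Proof. by elim: n => [//|n IH]; rewrite !exprS rcM IH. Qed.
Lemma rcJ (a : R) : ((a%:C%C : Cplx R)^* : Cplx R) = a%:C%C.
Proof. by apply: Cplx_eq; rewrite !partE ?oppr0. Qed.
Lemma rcV (a : R) : ((a^-1)%:C = (a%:C)^-1 :> Cplx R)%C.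
Proof.
have [->|a0] := eqVneq a 0; first by rewrite invr0; symmetry; exact: (@invr0 (Cplx R)).
have h : (a%:C : Cplx R)%C != 0 by apply/eqP => -[] /eqP; rewrite (negPf a0).
by apply: (mulfI h); rewrite -rcM !mulfV.
Qed.
Lemma rc_inj (a b : R) : (a%:C = b%:C :> Cplx R)%C -> a = b.
Proof. by case. Qed.

(** Norms of complex numbers are again complex here; the real-valued squared
    modulus keeps every estimate inside the ordered field R. *)
Definition csq x : R := complex.Re x ^+ 2 + complex.Im x ^+ 2.

Lemma csq_ge0 x : 0 <= csq x.
Proof. by rewrite /csq addr_ge0 // sqr_ge0. Qed.
Lemma csqM x y : csq (x * y) = csq x * csq y.
Proof. rewrite /csq !partE; ring. Qed.
Lemma csqJ x : csq (x^* : Cplx R) = csq x.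
Proof. by rewrite /csq !partE sqrrN. Qed.
Lemma csqX x n : csq (x ^+ n) = csq x ^+ n.
Proof.
elim: n => [|n IH]; first by rewrite !expr0 /csq !partE expr1n expr0n addr0.
by rewrite !exprS csqM IH.
Qed.
Lemma mulJ_csq x : x * (x^* : Cplx R) = (csq x)%:C%C.
Proof. by apply: Cplx_eq; rewrite /csq !partE; ring. Qed.
Lemma csq_eq0 x : csq x = 0 -> x = 0.
Proof.
move/eqP; rewrite /csq paddr_eq0 ?sqr_ge0 // !sqrf_eq0 => /andP[/eqP a /eqP b].
exact: Cplx_eq.
Qed.
Lemma csq_lt1 x : `|x| < 1 -> csq x < 1.
Proof.
move=> h; have : (csq x)%:C%C < (1 : R[i]).
  by rewrite -mulJ_csq -[x * _]normCK expr_lt1.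
by rewrite ltcE => /andP[].
Qed.
End ComplexParts.

(** * Inner products and norm limits *)

Section HilbertBasics.
Variables (R : realType) (H : hilbert R).
Implicit Types (x y z : H) (c : Cplx R) (a b : R).
Local Notation "''[' x , y ]" := (hdot H x y) : ring_scope.

Lemma dotDl x y z : '[x + y, z] = '[x, z] + '[y, z].
Proof. exact: (linearDl (hdot H)). Qed.
Lemma dotDr x y z : '[x, y + z] = '[x, y] + '[x, z].
Proof. exact: (linearDr (hdot H)). Qed.
Lemma dotNl x z : '[- x, z] = - '[x, z].
Proof. exact: (linearNl (hdot H)). Qed.
Lemma dotNr x z : '[x, - z] = - '[x, z].
Proof. exact: (linearNr (hdot H)). Qed.
Lemma dot0l x : '[0, x] = 0. Proof. exact: (linear0l (hdot H)). Qed.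
Lemma dot0r x : '[x, 0] = 0. Proof. exact: (linear0r (hdot H)). Qed.
Lemma dotBl x y z : '[x - y, z] = '[x, z] - '[y, z].
Proof. by rewrite dotDl dotNl. Qed.
Lemma dotBr x y z : '[x, y - z] = '[x, y] - '[x, z].
Proof. by rewrite dotDr dotNr. Qed.
Lemma dotZl c x y : '[c *: x, y] = c * '[x, y].
Proof. exact: (linearZl_LR (hdot H)). Qed.
Lemma dotZr c x y : '[x, c *: y] = (c^* : Cplx R) * '[x, y].
Proof. exact: (linearZr_LR (hdot H)). Qed.
Lemma dotC x y : '[x, y] = ('[y, x]^* : Cplx R).
Proof. by rewrite (hermC (hdot H)) expr0 mul1r. Qed.
Lemma dot_suml I (r : seq I) (P : pred I) (F : I -> H) y :
  '[\sum_(i <- r | P i) F i, y] = \sum_(i <- r | P i) '[F i, y].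
Proof.
by elim/big_rec2: _ => [|i a b _ <-]; rewrite ?dot0l ?dotDl.
Qed.
Lemma dot_sumr I (r : seq I) (P : pred I) (F : I -> H) y :
  '[y, \sum_(i <- r | P i) F i] = \sum_(i <- r | P i) '[y, F i].
Proof.
by elim/big_rec2: _ => [|i a b _ <-]; rewrite ?dot0r ?dotDr.
Qed.

(** Squared norms replace norms throughout, so that no square root enters
    the estimates. *)
Definition nsq x : R := complex.Re '[x, x].

Lemma dot_nsq x : '[x, x] = (nsq x)%:C%C.
Proof.
apply: Cplx_eq => //; have := congr1 (@complex.Im R) (dotC x x).
rewrite ImJ ImC => h; lra.
Qed.
Lemma nsq_ge0 x : 0 <= nsq x.
Proof.
have : (0 : R[i]) <= '[x, x] by exact: dnorm_ge0.
by rewrite lecE => /andP[].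
Qed.
Lemma nsq_eq0 x : nsq x = 0 -> x = 0.
Proof.
move=> h; apply/eqP; rewrite -(dnorm_eq0 (hdot H)); apply/eqP.
by rewrite dot_nsq h.
Qed.
Lemma nsq0 : nsq 0 = 0. Proof. by rewrite /nsq dot0l. Qed.

Lemma nsqZ c x : nsq (c *: x) = csq c * nsq x.
Proof. by rewrite /nsq dotZl dotZr dot_nsq /csq !partE /=; ring. Qed.

(** The real part of the inner product is a real inner product; the imaginary
    part is recovered from it by Im_rdot, so real limits suffice. *)
Definition rdot x y : R := complex.Re '[x, y].

Lemma rdotC x y : rdot x y = rdot y x.
Proof. by rewrite /rdot dotC ReJ. Qed.
Lemma nsqD x y : nsq (x + y) = nsq x + nsq y + 2 * rdot x y.
Proof.
rewrite /nsq dotDl !dotDr !ReD -!/(rdot _ _) (rdotC y x); ring.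
Qed.
Lemma nsqN x : nsq (- x) = nsq x.
Proof. by rewrite /nsq dotNl dotNr opprK. Qed.
Lemma rdotNr x y : rdot x (- y) = - rdot x y.
Proof. by rewrite /rdot dotNr ReN. Qed.
Lemma nsqB x y : nsq (x - y) = nsq x + nsq y - 2 * rdot x y.
Proof. rewrite nsqD nsqN rdotNr; ring. Qed.
Lemma nsqC x y : nsq (x - y) = nsq (y - x).
Proof. by rewrite -nsqN opprB. Qed.
Lemma nsqD_le x y : nsq (x + y) <= 2 * nsq x + 2 * nsq y.
Proof. have := nsq_ge0 (x - y); rewrite nsqB nsqD; lra. Qed.

Lemma rdot_le x y : `|rdot x y| <= nsq x + nsq y.
Proof.
have h1 := nsq_ge0 (x + y); have h2 := nsq_ge0 (x - y).
move: h1 h2; rewrite nsqB nsqD ler_norml => h1 h2.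
have h3 := nsq_ge0 x; have h4 := nsq_ge0 y.
by apply/andP; split; lra.
Qed.

(** The quadratic polynomial t |-> nsq (x + t y) is nonnegative; its value at
    the minimizing t is the inequality. *)
Lemma CauchySchwarz_rdot x y : rdot x y ^+ 2 <= nsq x * nsq y.
Proof.
have h (t : R) : 0 <= nsq x + t ^+ 2 * nsq y + 2 * (t * rdot x y).
  have := nsq_ge0 (x + t%:C%C *: y); rewrite nsqD nsqZ /rdot dotZr rcJ.
  by rewrite /csq !partE expr0n addr0 mul0r subr0.
have [y0|y0] := eqVneq (nsq y) 0.
  move: h; rewrite y0 (nsq_eq0 y0) /rdot dot0r Re0 => _.
  by rewrite expr0n mulr0.
have yp : 0 < nsq y by rewrite lt_def y0 nsq_ge0.
have := h (- rdot x y / nsq y).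
rewrite (_ : _ + _ = nsq x - rdot x y ^+ 2 / nsq y); last by field.
by rewrite subr_ge0 ler_pdivrMr.
Qed.

Lemma Im_rdot x y : complex.Im '[x, y] = rdot x ('i%C *: y).
Proof.
rewrite /rdot dotZr ReM !ReJ !ImJ /=; ring.
Qed.

Lemma hnorm_nsq x : dot_norm (hdot H) x = Num.sqrt (nsq x).
Proof. by []. Qed.

Definition hcvg (u : nat -> H) (l : H) : Prop :=
  (fun n => nsq (u n - l)) @ \oo --> (0 : R).

Lemma hcomplete_nsq (u : nat -> H) :
  (forall e : R, 0 < e -> exists N : nat, forall m n : nat,
     (N <= m)%N -> (N <= n)%N -> nsq (u m - u n) < e) ->
  exists l, hcvg u l.
Proof.
move=> h; have [|l hl] := @hcomplete _ H u.
  move=> e e0; have [|N hN] := h (e ^+ 2); first by rewrite exprn_gt0.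
  exists N => m n Nm Nn; rewrite hnorm_nsq -(ger0_norm (ltW e0)) -sqrtr_sqr.
  by rewrite ltr_sqrt ?hN ?exprn_gt0.
exists l; apply/cvgrPdist_lt => e e0.
have [|N hN] := hl (Num.sqrt e); first by rewrite sqrtr_gt0.
exists N => // n /= Nn; rewrite sub0r normrN ger0_norm ?nsq_ge0 //.
by have := hN n Nn; rewrite hnorm_nsq ltr_sqrt.
Qed.

Lemma hcvg_rdot (u : nat -> H) l y : hcvg u l ->
  (fun n => rdot (u n) y) @ \oo --> rdot l y.
Proof.
move=> h; apply/subr_cvg0/cvgr0_sqr.
have h2 : (fun n => nsq (u n - l) * nsq y) @ \oo --> (0 : R).
  by rewrite -(mul0r (nsq y)); apply: cvgMl.
apply: squeeze0 h2 => n; rewrite sqr_ge0 /=.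
have := CauchySchwarz_rdot (u n - l) y.
by rewrite {1}/rdot dotBl ReD ReN.
Qed.

Lemma hcvg_Re_dot u l y : hcvg u l ->
  (fun n => complex.Re '[u n, y]) @ \oo --> complex.Re '[l, y].
Proof. exact: hcvg_rdot. Qed.
Lemma hcvg_Im_dot u l y : hcvg u l ->
  (fun n => complex.Im '[u n, y]) @ \oo --> complex.Im '[l, y].
Proof.
move=> /(@hcvg_rdot _ _ ('i%C *: y)); rewrite -Im_rdot.
by under eq_fun do rewrite -Im_rdot.
Qed.

Lemma hcvg_nsq u l : hcvg u l -> (fun n => nsq (u n)) @ \oo --> nsq l.
Proof.
move=> h.
apply: (seq_cvg_eq (seqD h (seqB (seqZ (c := 2) (hcvg_rdot (y := l) h))
  (cvg_cst (nsq l))))).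
  by move=> n /=; rewrite nsqB; ring.
by rewrite /nsq /rdot; ring.
Qed.
End HilbertBasics.

(** * Power series with nonnegative coefficients *)

Section PowerSeries.
Variable R : realType.

(** Convergence of both parts. Complex limits are only ever compared through
    this notion; ccvg_cvg transfers it to the topology in which the kernels are
    defined. *)
Definition ccvg (u : nat -> Cplx R) (l : Cplx R) : Prop :=
  ((fun n => complex.Re (u n)) @ \oo --> complex.Re l) /\
  ((fun n => complex.Im (u n)) @ \oo --> complex.Im l).

Lemma ccvg_uniq u l l' : ccvg u l -> ccvg u l' -> l = l'.
Proof. by move=> [a b] [c d]; apply: Cplx_eq; apply: seq_uniq; eauto. Qed.

Lemma ccvgD u v l m : ccvg u l -> ccvg v m ->
  ccvg (fun n => u n + v n) (l + m).
Proof.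
move=> [a b] [c d]; split; rewrite ?ReD ?ImD.
  by under eq_fun do rewrite ReD; exact: seqD.
by under eq_fun do rewrite ImD; exact: seqD.
Qed.

Lemma ccvg_cst c : ccvg (fun=> c) c.
Proof. by split; exact: cvg_cst. Qed.

Lemma ccvgM u v l m : ccvg u l -> ccvg v m ->
  ccvg (fun n => u n * v n) (l * m).
Proof.
move=> [a b] [c d]; split; rewrite ?ReM ?ImM.
  by under eq_fun do rewrite ReM; apply: seqB; exact: seqM.
by under eq_fun do rewrite ImM; apply: seqD; exact: seqM.
Qed.

Lemma ccvgB u v l m : ccvg u l -> ccvg v m ->
  ccvg (fun n => u n - v n) (l - m).
Proof.
move=> [a b] [c d]; split; rewrite ?ReD ?ImD ?ReN ?ImN.
  by under eq_fun do rewrite ReD ReN; exact: seqB.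
by under eq_fun do rewrite ImD ImN; exact: seqB.
Qed.

Lemma ccvgJ (u : nat -> Cplx R) l : ccvg u l ->
  ccvg (fun n => (u n)^*) (l^* : Cplx R).
Proof.
move=> [h1 h2]; split; first by apply: (seq_cvg_eq h1) => [n|]; rewrite ReJ.
by apply: (seq_cvg_eq (seqZ (c := -1) h2)) => [n|] /=; rewrite ImJ mulN1r.
Qed.

Lemma ccvg_eq u v l m : ccvg v m -> u =1 v -> m = l -> ccvg u l.
Proof. by move=> vm /funext -> <-. Qed.

Lemma ccvg_csq0 u l : (fun n => csq (u n - l)) @ \oo --> (0 : R) -> ccvg u l.
Proof.
move=> h; split; apply/subr_cvg0/cvgr0_sqr; apply: squeeze0 h => n;
  rewrite sqr_ge0 /= /csq !partE ?lerDl ?lerDr ?sqr_ge0 //.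
Qed.

Lemma ccvg_cvg (u : nat -> Cplx R) (l : Cplx R) : ccvg u l -> u @ \oo --> l.
Proof.
move=> [hr hi]; apply/cvgrPdist_lt => e e0.
have e0' : 0 < complex.Re e by move: (e0); rewrite ltcE => /andP[].
have eE : e = (complex.Re e)%:C%C.
  by apply: Cplx_eq => //; rewrite ImC; move: (e0); rewrite ltcE => /andP[/eqP].
have e2 : 0 < complex.Re e / 2 by rewrite divr_gt0.
have /cvgrPdist_lt/(_ _ e2)[N _ hN] := hr.
have /cvgrPdist_lt/(_ _ e2)[M _ hM] := hi.
exists (maxn N M) => // n /=; rewrite geq_max => /andP[Nn Mn].
have := hN n Nn; have := hM n Mn => /=.
set d := l - u n.
rewrite -ReN -ReD -ImN -ImD -/d => h1 h2.
rewrite eE normc_def ltcR -[ltRHS]ger0_norm ?ltW // -sqrtr_sqr.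
rewrite ltr_sqrt ?exprn_gt0 //.
have ? : complex.Re d ^+ 2 <= (complex.Re e / 2) ^+ 2.
  by rewrite -[leLHS]real_normK ?num_real // ler_sqr ?nnegrE // ltW.
have ? : complex.Im d ^+ 2 <= (complex.Re e / 2) ^+ 2.
  by rewrite -[leLHS]real_normK ?num_real // ler_sqr ?nnegrE // ltW.
have ? : 0 < complex.Re e ^+ 2 by rewrite exprn_gt0.
lra.
Qed.

(** A series is the difference of the two nonnegative series with terms
    f + |f| and |f|, whose partial sums are monotone and bounded. *)
Lemma abs_summable (f : nat -> R) (M : R) :
  (forall n, \sum_(k < n) `|f k| <= M) ->
  exists l : R, (fun n => \sum_(k < n) f k) @ \oo --> l.
Proof.
move=> h.
have [l1 h1 _] : exists2 l : R, (fun n => \sum_(k < n) `|f k|) @ \oo --> l &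
    forall n, \sum_(k < n) `|f k| <= l.
  by apply: nondecr_bounded_cvg (h) => n; rewrite big_ord_recr lerDl.
have [l2 h2 _] : exists2 l : R, (fun n => \sum_(k < n) (f k + `|f k|)) @ \oo --> l &
    forall n, \sum_(k < n) (f k + `|f k|) <= l.
  apply: (@nondecr_bounded_cvg _ _ (M + M)) => n.
    rewrite big_ord_recr lerDl -lerBlDr sub0r lerNl.
    by rewrite -normrN ler_norm.
  rewrite big_split /= lerD ?h //; apply: le_trans (h n).
  by apply: ler_sum => k _; exact: ler_norm.
exists (l2 - l1); apply: seq_cvg_eq (seqB h2 h1) _ _ => // n.
by rewrite -sumrB; apply: eq_bigr => k _; rewrite addrK.
Qed.

Variable a : nat -> R.
Hypothesis a_ge0 : forall k, 0 <= a k.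

(** For nonnegative b this says that the power series with coefficients b
    converges on the open unit disc. *)
Definition disc_summable (b : nat -> R) : Prop :=
  forall q : R, 0 <= q < 1 -> exists M : R, forall n, \sum_(k < n) b k * q ^+ k <= M.
Hypothesis a_disc : disc_summable a.

Definition psum (x : Cplx R) n : Cplx R := \sum_(k < n) (a k)%:C%C * x ^+ k.

Lemma csq_sqrt (x : Cplx R) : csq x = Num.sqrt (csq x) ^+ 2.
Proof. by rewrite sqr_sqrtr // csq_ge0. Qed.

Lemma Re_le_csq (x : Cplx R) q : 0 <= q -> csq x <= q ^+ 2 ->
  `|complex.Re x| <= q.
Proof.
move=> q0 h; rewrite -ler_sqr ?nnegrE // real_normK ?num_real //.
by apply: le_trans h; rewrite /csq lerDl sqr_ge0.
Qed.
Lemma Im_le_csq (x : Cplx R) q : 0 <= q -> csq x <= q ^+ 2 ->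
  `|complex.Im x| <= q.
Proof.
move=> q0 h; rewrite -ler_sqr ?nnegrE // real_normK ?num_real //.
by apply: le_trans h; rewrite /csq lerDr sqr_ge0.
Qed.

Lemma psum_cvg x : csq x < 1 -> exists l, ccvg (psum x) l.
Proof.
move=> x1; set q := Num.sqrt (csq x).
have q0 : 0 <= q by exact: sqrtr_ge0.
have qE : csq x = q ^+ 2 by exact: csq_sqrt.
have q1 : q < 1 by rewrite -(@ltr_sqr _ q 1) ?nnegrE // expr1n -qE.
have [M hM] := a_disc (introT andP (conj q0 q1)).
have xk k : csq (x ^+ k) <= (q ^+ k) ^+ 2.
  by rewrite csqX -exprM mulnC exprM -qE.
have [l1 h1] : exists l : R, (fun n => \sum_(k < n) (a k * complex.Re (x ^+ k))) @ \oo --> l.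
  apply: (@abs_summable (fun k => a k * complex.Re (x ^+ k)) M) => n; apply: le_trans (hM n).
  apply: ler_sum => k _; rewrite normrM ger0_norm // ler_wpM2l //.
  by apply: Re_le_csq => //; exact: exprn_ge0.
have [l2 h2] : exists l : R, (fun n => \sum_(k < n) (a k * complex.Im (x ^+ k))) @ \oo --> l.
  apply: (@abs_summable (fun k => a k * complex.Im (x ^+ k)) M) => n; apply: le_trans (hM n).
  apply: ler_sum => k _; rewrite normrM ger0_norm // ler_wpM2l //.
  by apply: Im_le_csq => //; exact: exprn_ge0.
exists (Complex l1 l2); split => /=.
  apply: seq_cvg_eq h1 _ _ => // n; rewrite Re_sum; apply: eq_bigr => k _.
  by rewrite !partE mul0r subr0.
apply: seq_cvg_eq h2 _ _ => // n; rewrite Im_sum; apply: eq_bigr => k _.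
by rewrite !partE mul0r addr0.
Qed.

(** On |x| <= 1/2 every term of order at least i+1 is at most |x|^(i+1) times
    the corresponding term at 1/2, rescaled. The constant depends only on i,
    which is what makes the limits defining the monomials uniform. *)
Lemma psum_tail i : exists2 C : R, 0 <= C & forall x l, csq x <= 4^-1 ->
  ccvg (psum x) l -> csq (l - psum x i.+1) <= C * csq x ^+ i.+1.
Proof.
have [|M hM] := a_disc (q := 2^-1).
  by rewrite invr_ge0 ler0n invf_lt1 ?ltr1n.
have M0 : 0 <= M by have := hM 0%N; rewrite big_ord0.
exists (2 * (2 ^+ i.+1 * M) ^+ 2); first by rewrite mulr_ge0 // sqr_ge0.
move=> x l x4 hl; set q := Num.sqrt (csq x).
have q0 : 0 <= q by exact: sqrtr_ge0.
have qE : csq x = q ^+ 2 by exact: csq_sqrt.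
have q2 : q <= 2^-1.
  by rewrite -(@ler_sqr _ q 2^-1) ?nnegrE ?invr_ge0 // -qE exprVn -natrX.
have xk k : csq (x ^+ k) <= (q ^+ k) ^+ 2.
  by rewrite csqX -exprM mulnC exprM -qE.
pose B := 2 ^+ i.+1 * M * q ^+ i.+1.
have tail n : psum x (n + i.+1)%N - psum x i.+1 =
    \sum_(k < n) (a (k + i.+1)%N)%:C%C * x ^+ (k + i.+1).
  elim: n => [|n IH]; first by rewrite add0n subrr big_ord0.
  by rewrite addSn /psum big_ord_recr /= -/(psum _ _) addrAC IH big_ord_recr.
have bnd n : \sum_(k < n) a (k + i.+1)%N * q ^+ (k + i.+1) <= B.
  have -> : B = q ^+ i.+1 * (2 ^+ i.+1 * M) by rewrite /B mulrC.
  have : \sum_(k < n) a (k + i.+1)%N * 2^-1 ^+ (k + i.+1) <= M.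
    apply: le_trans (hM (i.+1 + n)%N).
    rewrite big_split_ord /= -[leLHS]add0r lerD //.
      by apply: sumr_ge0 => k _; rewrite mulr_ge0 // exprn_ge0 // invr_ge0.
    by apply: ler_sum => k _; rewrite addnC.
  move=> h; apply: le_trans (_ : q ^+ i.+1 * (2 ^+ i.+1 *
     \sum_(k < n) a (k + i.+1)%N * 2^-1 ^+ (k + i.+1)) <= _).
    rewrite !mulr_sumr; apply: ler_sum => k _.
    rewrite [leRHS](_ : _ = a (k + i.+1)%N * (2^-1 ^+ k * q ^+ i.+1)).
      by rewrite ler_wpM2l // exprD ler_wpM2r ?exprn_ge0 // lerXn2r ?nnegrE // invr_ge0.
    have h2 : (2 : R) ^+ i.+1 * 2^-1 ^+ i.+1 = 1.
      by rewrite -exprMn divff ?expr1n // pnatr_eq0.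
    rewrite exprD; set A := a _; set X := 2^-1 ^+ k; move: h2.
    set Y := 2^-1 ^+ _; set Z := 2 ^+ _; set W := q ^+ _ => h2.
    have -> : W * (Z * (A * (X * Y))) = A * (X * W) * (Z * Y) by ring.
    by rewrite h2 mulr1.
  by rewrite ler_wpM2l ?exprn_ge0 // ler_wpM2l // exprn_ge0.
have B0 : 0 <= B by rewrite /B !mulr_ge0 // exprn_ge0.
have hS : ccvg (fun n => psum x (n + i.+1)%N - psum x i.+1) (l - psum x i.+1).
  by apply: ccvgB (ccvg_cst _); case: hl => [u v]; split;
    [exact: (seq_shift i.+1 u)|exact: (seq_shift i.+1 v)].
have bR : `|complex.Re (l - psum x i.+1)| <= B.
  have hs : (fun n => `|complex.Re (psum x (n + i.+1)%N - psum x i.+1)|) @ \oo -->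
      `|complex.Re (l - psum x i.+1)| by apply: cvg_norm; exact: hS.1.
  apply: (seq_le hs (cvg_cst B)) => n /=.
  rewrite tail Re_sum; apply: le_trans (ler_norm_sum _ _ _) _.
  apply: le_trans (bnd n); apply: ler_sum => k _.
  rewrite !partE mul0r subr0 normrM ger0_norm // ler_wpM2l //.
  by apply: Re_le_csq => //; exact: exprn_ge0.
have bI : `|complex.Im (l - psum x i.+1)| <= B.
  have hs : (fun n => `|complex.Im (psum x (n + i.+1)%N - psum x i.+1)|) @ \oo -->
      `|complex.Im (l - psum x i.+1)| by apply: cvg_norm; exact: hS.2.
  apply: (seq_le hs (cvg_cst B)) => n /=.
  rewrite tail Im_sum; apply: le_trans (ler_norm_sum _ _ _) _.
  apply: le_trans (bnd n); apply: ler_sum => k _.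
  rewrite !partE mul0r addr0 normrM ger0_norm // ler_wpM2l //.
  by apply: Im_le_csq => //; exact: exprn_ge0.
have -> : 2 * (2 ^+ i.+1 * M) ^+ 2 * csq x ^+ i.+1 = B ^+ 2 + B ^+ 2.
  rewrite qE /B [(q ^+ 2) ^+ _]exprAC; ring.
rewrite /csq; apply: lerD.
  by rewrite -[leLHS]real_normK ?num_real // ler_sqr ?nnegrE.
by rewrite -[leLHS]real_normK ?num_real // ler_sqr ?nnegrE.
Qed.

End PowerSeries.

Section DiscSummable.
Variable R : realType.
Implicit Types c d : nat -> R.

(** Multiplying a power series by 1 - q replaces its coefficients by their
    increments. Applied repeatedly, this bounds any polynomial weight without
    computing a closed form. *)
Lemma disc_summable_incr c d : (forall k, 0 <= c k) ->
  c 0%N <= d 0%N -> (forall k, c k.+1 - c k <= d k.+1) ->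
  disc_summable d -> disc_summable c.
Proof.
move=> c0 cd0 cdS hd q /andP[q0 q1]; have [|M hM] := hd q; first exact/andP.
have p : 0 < 1 - q by rewrite subr_gt0.
have key n : (1 - q) * (\sum_(k < n.+1) c k * q ^+ k) + c n * q ^+ n.+1 <=
    \sum_(k < n.+1) d k * q ^+ k.
  elim: n => [|n IH].
    rewrite !big_ord_recr !big_ord0 /= !add0r !expr0 expr1.
    have -> : (1 - q) * (c 0%N * 1) + c 0%N * q = c 0%N by ring.
    by rewrite mulr1.
  rewrite big_ord_recr [leRHS]big_ord_recr /=.
  have h : (c n.+1 - c n) * q ^+ n.+1 <= d n.+1 * q ^+ n.+1.
    by rewrite ler_wpM2r // exprn_ge0.
  apply: le_trans (lerD IH h); rewrite le_eqVlt; apply/orP; left.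
  by apply/eqP; rewrite [q ^+ n.+2]exprS; ring.
exists (M / (1 - q)) => n; rewrite ler_pdivlMr //.
case: n => [|n]; first by rewrite big_ord0 mul0r; have := hM 0%N; rewrite big_ord0.
rewrite mulrC; apply: le_trans (hM n.+1); apply: le_trans (key n).
by rewrite lerDl mulr_ge0 // exprn_ge0.
Qed.

Lemma disc_summable_le c d : (forall k, c k <= d k) ->
  disc_summable d -> disc_summable c.
Proof.
move=> cd hd q q01; have [M hM] := hd q q01; exists M => n.
apply: le_trans (hM n); apply: ler_sum => k _; rewrite ler_wpM2r //.
by case/andP: q01 => q0 _; rewrite exprn_ge0.
Qed.

Lemma disc_summable_quadratic (C : R) : 0 <= C ->
  disc_summable (fun k => C * k.+1%:R ^+ 2).
Proof.
move=> C0.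
have h0 : disc_summable (fun k => C *+ (k == 0%N)).
  move=> q _; exists C => -[|n]; rewrite ?big_ord0 //.
  by rewrite big_ord_recl /= big1 ?addr0 ?expr0 ?mulr1 // => i _; rewrite mul0r.
have h1 : disc_summable (fun=> C).
  by apply: disc_summable_incr h0 => //= k; rewrite subrr.
have h2 : disc_summable (fun k => C * k.+1%:R).
  apply: disc_summable_incr h1 => [k||k]; first by rewrite mulr_ge0.
    by rewrite mulr1.
  by rewrite -mulrBr -(natr1 k.+1) addrAC subrr add0r mulr1.
have h3 : disc_summable (fun k => (2 * C) * k.+1%:R).
  move=> q q01; have [M hM] := h2 q q01; exists (2 * M) => n.
  by under eq_bigr do rewrite -!mulrA; rewrite -mulr_sumr ler_wpM2l //;
    under eq_bigr do rewrite mulrA.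
apply: disc_summable_incr h3 => [k||k]; first by rewrite mulr_ge0 // sqr_ge0.
  by rewrite expr1n !mulr1; lra.
rewrite -(natr1 k.+1); set x := k.+1%:R.
have : 0 <= C * x by rewrite mulr_ge0 // ler0n.
nra.
Qed.
End DiscSummable.

Section KernelValue.
Variable R : realType.

Lemma diag_kernel_cvg (a : nat -> R) (z w : disc R) :
  (forall k, 0 <= a k) -> disc_summable a ->
  ccvg (psum a (val z * (val w)^*)) (diag_kernel a z w).
Proof.
move=> a0 ad; have [|l hl] := psum_cvg a0 ad (x := val z * (val w)^*).
  have := csq_lt1 (valP z); have := csq_lt1 (valP w).
  rewrite csqM csqJ; have := csq_ge0 (val z); have := csq_ge0 (val w).
  by move=> *; rewrite mulr_ilt1.
suff -> : diag_kernel a z w = l by [].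
have -> : diag_kernel a z w = limn (psum a (val z * (val w)^*)).
  by congr (limn _); apply/funext => n; rewrite /series /= big_mkord.
exact: cvg_lim (ccvg_cvg hl).
Qed.

Definition kcoef (r s t : R) (k : nat) : R :=
  (k%:R + r) / r + (k%:R + s) * (k%:R + t) / (s * t).

Lemma sum_kernel_cvg (r s t : R) (z w : disc R) : 0 < r -> 0 < s -> 0 < t ->
  ccvg (psum (kcoef r s t) (val z * (val w)^*))
    (kernel1 r z w + kernel2 s t z w).
Proof.
move=> r0 s0 t0.
have bnd (u : R) (k : nat) : 0 < u -> (k%:R + u) / u <= (1 + u^-1) * k.+1%:R.
  move=> u0; have -> : (k%:R + u) / u = k%:R * u^-1 + 1.
    by field; rewrite gt_eqF.
  rewrite -natr1.
  have : 0 <= u^-1 by rewrite invr_ge0 ltW.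
  have : 0 <= k%:R :> R by rewrite ler0n.
  nra.
have pos (u : R) (k : nat) : 0 < u -> 0 <= (k%:R + u) / u.
  by move=> u0; rewrite divr_ge0 ?addr_ge0 ?ler0n // ltW.
have ki (k : nat) : 1 <= k.+1%:R :> R by rewrite ler1n.
have iv (u : R) : 0 < u -> 0 <= 1 + u^-1.
  by move=> u0; rewrite addr_ge0 // invr_ge0 ltW.
have h1 := diag_kernel_cvg (a := fun k : nat => (k%:R + r) / r) z w.
have h2 := diag_kernel_cvg (a := fun k : nat => (k%:R + s) * (k%:R + t) / (s * t)) z w.
apply: ccvg_eq (ccvgD (h1 _ _) (h2 _ _)) _ _ => //.
- by move=> k; exact: pos.
- apply: disc_summable_le (@disc_summable_quadratic R (1 + r^-1) (iv _ r0)) => k.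
  apply: (le_trans (bnd _ k r0)); rewrite ler_wpM2l ?iv //.
  by rewrite expr2 ler_peMl // ler0n.
- by move=> k; rewrite invfM mulrACA mulr_ge0 ?pos.
- apply: disc_summable_le (@disc_summable_quadratic R
    ((1 + s^-1) * (1 + t^-1)) _) => [k|]; last by rewrite mulr_ge0 ?iv.
  by rewrite invfM mulrACA expr2 [leRHS]mulrACA ler_pM ?pos ?bnd.
- move=> n; rewrite /psum -big_split; apply: eq_bigr => k _ /=.
  by rewrite -mulrDl -rcD.
Qed.
End KernelValue.

(** * Monomials in a diagonal reproducing kernel space *)

Section WeakLimits.
Variables (R : realType) (H : hilbert R).

Lemma hcvg_ccvg (u : nat -> H) l y : hcvg u l ->
  ccvg (fun n => hdot H (u n) y) (hdot H l y).
Proof. by split; [exact: hcvg_Re_dot|exact: hcvg_Im_dot]. Qed.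

Lemma hcvg_ccvgr (u : nat -> H) l y : hcvg u l ->
  ccvg (fun n => hdot H y (u n)) (hdot H y l).
Proof.
move=> /(@hcvg_ccvg _ _ y) [h1 h2]; split.
  by apply: seq_cvg_eq h1 _ _ => [n|]; rewrite (dotC y) ReJ.
by apply: (seq_cvg_eq (seqZ (c := -1) h2)) => [n|] /=; rewrite (dotC y) ImJ mulN1r.
Qed.
End WeakLimits.

Lemma cauchy_arith (R : realFieldType) (X Y Z A D p q x e : R) :
  X <= A + D * p -> Y <= A + D * q -> A - D * x <= Z ->
  0 <= D * p + D * q - 2 * (D * x) ->
  D * (4 * q) < e -> D * (4 * p) < e -> X + Y - 2 * Z < e.
Proof. by move=> *; lra. Qed.

Section DiagonalRKHS.
Variables (R : realType) (a : nat -> R).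
Hypothesis a_gt0 : forall k, 0 < a k.
Hypothesis a_disc : disc_summable a.
Variable K : disc R -> disc R -> Cplx R.
Hypothesis K_cvg : forall z w, ccvg (psum a (val z * (val w)^*)) (K z w).
Variable H : rkhs K.
Local Notation "''[' x , y ]" := (hdot H x y) : ring_scope.
Local Notation ks := (ksection H).

Let a_ge0 k : 0 <= a k. Proof. exact: ltW. Qed.
Let a_neq0 k : a k != 0. Proof. by rewrite gt_eqF. Qed.

Lemma rkhs_inj (f g : H) : (forall w, '[f, ks w] = '[g, ks w]) -> f = g.
Proof.
move=> h; apply: (@feval_inj _ _ H); apply/funext => w.
by rewrite !reproducing.
Qed.

Lemma dot_ks z w : '[ks w, ks z] = K z w.
Proof. by rewrite -reproducing ksectionE. Qed.

(** The function z |-> z^i, expressed through the reproducing property. *)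
Definition monomial i (e : H) : Prop := forall w, '[e, ks w] = val w ^+ i.

Definition monomial_basis n (e : nat -> H) : Prop :=
  (forall i, (i < n)%N -> monomial i (e i)) /\
  (forall i j, (i < n)%N -> (j < n)%N ->
     '[e i, e j] = if i == j then (a i)^-1%:C%C else 0).

Lemma monomial_uniq i e e' : monomial i e -> monomial i e' -> e = e'.
Proof. by move=> h h'; apply: rkhs_inj => w; rewrite h h'. Qed.

Lemma sqr_pow (q x : R) i :
  (q * x ^+ 2) ^+ i.+1 = q ^+ i.+1 * (x ^+ i) ^+ 2 * x ^+ 2.
Proof. by rewrite exprMn -!exprM -mulrA -exprD; congr (_ * _ ^+ _); lia. Qed.

Section NextMonomial.
Variables (i : nat) (e : nat -> H).
Hypothesis e_basis : monomial_basis i e.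

Let g w : H := ks w - \sum_(j < i) ((a j)%:C%C * (val w)^* ^+ j) *: e j.

Let dot_ks_e w j : (j < i)%N -> '[ks w, e j] = (val w)^* ^+ j.
Proof. by move=> ji; rewrite dotC e_basis.1 // rmorphXn. Qed.

Let g_e w j : (j < i)%N -> '[g w, e j] = 0.
Proof.
move=> ji; rewrite dotBl dot_ks_e // dot_suml (bigD1 (Ordinal ji)) //= big1.
  rewrite addr0 dotZl e_basis.2 // eqxx mulrAC -rcM mulfV //.
  by rewrite mul1r subrr.
move=> k /eqP kj; rewrite dotZl e_basis.2 // ifN ?mulr0 //.
by apply/eqP => E; apply: kj; apply: val_inj.
Qed.

Let g_ks w z : '[g w, ks z] = K z w - psum a (val z * (val w)^*) i.
Proof.
rewrite dotBl dot_ks dot_suml /psum; congr (_ - _); apply: eq_bigr => j _.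
by rewrite dotZl e_basis.1 // exprMn -mulrA [_ ^+ j * val z ^+ j]mulrC.
Qed.

Let rho n : R := n.+2%:R^-1.
Let rho_gt0 n : 0 < rho n. Proof. by rewrite invr_gt0. Qed.
Let rho_le n : rho n <= 2^-1.
Proof. by rewrite lef_pV2 ?posrE // ler_nat. Qed.
Let rho_csq n : csq (rho n)%:C%C = rho n ^+ 2.
Proof. by rewrite /csq !partE expr0n addr0. Qed.
Let rho_lt1 n : `|(rho n)%:C%C : Cplx R| < 1.
Proof.
rewrite normc_def -[X in _ < X]/((1 : R)%:C%C) ltcR !partE expr0n addr0 sqrtr_sqr.
rewrite ger0_norm ?ltW //; apply: le_lt_trans (rho_le n) _.
by rewrite invf_lt1 ?ltr1n.
Qed.
Let pt n : disc R := exist _ ((rho n)%:C%C : Cplx R) (rho_lt1 n).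
Let f n : H := ((rho n ^+ i)^-1 / a i)%:C%C *: g (pt n).

Let f_ks : exists2 D : R, 0 <= D & forall n z,
  csq ('[f n, ks z] - val z ^+ i) <= (D * rho n) ^+ 2 * csq (val z) ^+ i.+1.
Proof.
have [C C0 hC] := psum_tail a_ge0 a_disc i.
exists (Num.sqrt C / a i) => [|n z]; first by rewrite divr_ge0 ?sqrtr_ge0.
have vpt : (val (pt n))^* = (rho n)%:C%C by rewrite rcJ.
have z4 : csq (val z * (val (pt n))^*) <= 4^-1.
  rewrite csqM csqJ rho_csq; have := csq_lt1 (valP z).
  have := csq_ge0 (val z) => h1 h2.
  have : rho n ^+ 2 <= (2^-1) ^+ 2.
    by rewrite ler_sqr ?nnegrE ?invr_ge0 ?rho_le // ltW.
  rewrite exprVn -natrX => h3; have h4 : 0 <= rho n ^+ 2 by rewrite sqr_ge0.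
  nra.
have := hC _ _ z4 (K_cvg z (pt n)).
rewrite dotZl g_ks /psum big_ord_recr /= opprD addrA.
set S := \sum_(_ < _) _; set E := K _ _ - S - _ => hE.
have rn0 : rho n ^+ i != 0 by rewrite expf_neq0 // gt_eqF.
have Rn0 : ((rho n ^+ i)%:C%C : Cplx R) != 0.
  by apply/eqP => h; move: (rc_inj h) => /eqP; apply/negP.
have An0 : ((a i)%:C%C : Cplx R) != 0.
  by apply/eqP => h; move: (rc_inj h) => /eqP; apply/negP.
have -> : ((rho n ^+ i)^-1 / a i)%:C%C * (K z (pt n) - S) - val z ^+ i =
    ((rho n ^+ i)^-1 / a i)%:C%C * E.
  have hz : (val z * (val (pt n))^*) ^+ i = val z ^+ i * (rho n ^+ i)%:C%C.
    by rewrite vpt exprMn rcX.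
  rewrite /E hz !rcM !rcV; field; exact/andP.
rewrite csqM; move: hE; rewrite csqM csqJ rho_csq.
have -> : csq ((rho n ^+ i)^-1 / a i)%:C%C = (((rho n ^+ i)^-1 / a i) ^+ 2).
  by rewrite /csq !partE expr0n addr0.
move=> hE; apply: (le_trans (ler_wpM2l (sqr_ge0 _) hE)).
set sC := Num.sqrt C; have CE : C = sC ^+ 2 by rewrite sqr_sqrtr.
rewrite CE le_eqVlt; apply/orP; left; apply/eqP.
by rewrite sqr_pow; field; rewrite a_neq0.
Qed.

Let f_dot n m : '[f n, f m] = ((rho m ^+ i)^-1 / a i)%:C%C * '[f n, ks (pt m)].
Proof.
rewrite /f dotZr rcJ; congr (_ * _); rewrite !dotZl; congr (_ * _).
rewrite {2}/g dotBr dot_sumr big1 ?subr0 // => j _.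
by rewrite dotZr g_e ?mulr0.
Qed.

Let f_f : exists2 D : R, 0 <= D & forall n m,
  `|complex.Re '[f n, f m] - (a i)^-1| <= D * (rho n * rho m).
Proof.
have [D D0 hD] := f_ks; exists (D / a i) => [|n m]; first by rewrite divr_ge0.
have rm0 : rho m ^+ i != 0 by rewrite expf_neq0 // gt_eqF.
pose E : Cplx R := ((rho m ^+ i)^-1 / a i)%:C%C * ('[f n, ks (pt m)] - val (pt m) ^+ i).
have <- : complex.Re E = complex.Re '[f n, f m] - (a i)^-1.
  rewrite f_dot /E mulrBr /= -rcX -rcM ReD ReN; congr (_ - _); rewrite ReC.
  by field; rewrite a_neq0.
apply: Re_le_csq; first by rewrite !mulr_ge0 // ?invr_ge0 // ltW.
rewrite csqM; have := hD n (pt m).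
have -> : csq ((rho m ^+ i)^-1 / a i)%:C%C = (((rho m ^+ i)^-1 / a i) ^+ 2).
  by rewrite /csq !partE expr0n addr0.
rewrite [val _]/= rho_csq => h; apply: (le_trans (ler_wpM2l (sqr_ge0 _) h)).
rewrite le_eqVlt; apply/orP; left; apply/eqP.
by rewrite -[rho m ^+ 2]mul1r sqr_pow expr1n; field; rewrite a_neq0.
Qed.

Let rho_cvg : rho @ \oo --> (0 : R).
Proof. exact: (seqS (@cvg_harmonic R)). Qed.

(** The kernel section at rho, minus its terms of order below i, divided by
    a_i rho^i, tends to z^i as rho tends to 0. The mutual inner products of these
    approximants are values of the same power series, hence tend to 1/a_i; this
    gives both the Cauchy property and the norm of the limit. In this way the
    monomials are reached from the kernel sections alone, the only vectors that
    the abstract space is known to contain. *)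
Lemma next_monomial : exists v : H,
  [/\ monomial i v, '[v, v] = (a i)^-1%:C%C
    & forall j, (j < i)%N -> '[v, e j] = 0].
Proof.
have [D D0 hD] := f_f.
have [v hv] : exists v, hcvg f v.
  apply: hcomplete_nsq => eps eps0.
  have h : (fun n => D * (4 * (rho n * rho n))) @ \oo --> (0 : R).
    have -> : (0 : R) = D * (4 * (0 * 0)) by ring.
    by do 2![apply: seqZ]; apply: seqM.
  have /cvgrPdist_lt /(_ _ eps0) [N _ hN] := h; exists N => m n Nm Nn.
  have := hN m Nm; have := hN n Nn.
  have pos k : 0 <= D * (4 * (rho k * rho k)) by rewrite !mulr_ge0 // ltW.
  rewrite /= !sub0r !normrN !ger0_norm ?pos // => hn hm.
  rewrite nsqB /rdot /nsq.
  have hD' k l : (a i)^-1 - D * (rho k * rho l) <= complex.Re '[f k, f l] <=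
      (a i)^-1 + D * (rho k * rho l) by rewrite -ler_distl.
  have /andP[_ h1] := hD' m m; have /andP[_ h2] := hD' n n.
  have /andP[h3 _] := hD' m n.
  have h4 : 0 <= D * (rho m - rho n) ^+ 2 by rewrite mulr_ge0 // sqr_ge0.
  have h5 : D * (rho m - rho n) ^+ 2 = D * (rho m * rho m) +
    D * (rho n * rho n) - 2 * (D * (rho m * rho n)) by ring.
  rewrite h5 in h4; exact: (cauchy_arith h1 h2 h3 h4 hn hm).
exists v; split.
- move=> w; have [D1 D10 hD1] := f_ks.
  apply: (@ccvg_uniq _ (fun n => '[f n, ks w])).
    by split; [exact: hcvg_Re_dot|exact: hcvg_Im_dot].
  apply: ccvg_csq0.
  have h : (fun n => (D1 * rho n) ^+ 2) @ \oo --> (0 : R).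
    have -> : (0 : R) = (D1 * 0) * (D1 * 0) by ring.
    by under eq_fun do rewrite expr2; apply: seqM; exact: seqZ.
  apply: squeeze0 h => n; rewrite csq_ge0 /=; apply: le_trans (hD1 n w) _.
  rewrite ler_piMr ?sqr_ge0 // exprn_ile1 ?csq_ge0 // ltW //.
  exact: csq_lt1 (valP w).
- rewrite dot_nsq; congr (_%:C%C); apply: seq_uniq (hcvg_nsq hv) _.
  apply/subr_cvg0.
  have h : (fun n => D * (rho n * rho n)) @ \oo --> (0 : R).
    have -> : (0 : R) = D * (0 * 0) by ring.
    by apply: seqZ; apply: seqM.
  apply/norm_cvg0P; apply: squeeze0 h => n; rewrite normr_ge0 /=; exact: hD.
- move=> j ji; apply: (@ccvg_uniq _ (fun n => '[f n, e j])).
    by split; [exact: hcvg_Re_dot|exact: hcvg_Im_dot].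
  apply: ccvg_eq (ccvg_cst 0) _ _ => // n.
  by rewrite dotZl g_e ?mulr0.
Qed.
End NextMonomial.

(** The distinct monomials are orthogonal and z^i has squared norm 1/a_i:
    multiplication by z is a weighted shift. *)
Lemma monomial_basis_exists : exists e : nat -> H,
  (forall i, monomial i (e i)) /\
  (forall i j, '[e i, e j] = if i == j then (a i)^-1%:C%C else 0).
Proof.
have h n : exists e, monomial_basis n e.
  elim: n => [|n [e he]]; first by exists (fun=> 0).
  have [v [v1 v2 v3]] := next_monomial he.
  exists (fun k => if k == n then v else e k); split=> [k|k j]; rewrite !ltnS (leq_eqVlt k).
    by case: eqP => [-> //|_ /= kn]; exact: he.1.
  rewrite (leq_eqVlt j).
  case: (eqVneq k n) => [->|kn] /=; case: (eqVneq j n) => [->|jn] /= hk hj.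
  - exact: v2.
  - by rewrite v3.
  - by rewrite dotC v3 // conjC0 (negPf kn).
  - exact: he.2.
have [E hE] := choice h; pose e n := E n.+1 n.
have m n k : (n < k)%N -> E k n = e n.
  move=> nk; apply: (@monomial_uniq n); first exact: (hE k).1.
  exact: (hE n.+1).1.
exists e; split=> [i|i j]; first exact: (hE i.+1).1.
have li : (i < (maxn i j).+1)%N by rewrite ltnS leq_maxl.
have lj : (j < (maxn i j).+1)%N by rewrite ltnS leq_maxr.
by rewrite -(m _ _ li) -(m _ _ lj) (hE _).2.
Qed.
End DiagonalRKHS.

(** * Expansion in monomials and the operator of multiplication *)

Section Expansion.
Variables (R : realType) (a : nat -> R).
Hypothesis a_gt0 : forall k, 0 < a k.
Variable K : disc R -> disc R -> Cplx R.
Hypothesis K_cvg : forall z w, ccvg (psum a (val z * (val w)^*)) (K z w).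
Variable H : rkhs K.
Variable e : nat -> H.
Hypothesis e_monomial : forall i, monomial i (e i).
Local Notation "''[' x , y ]" := (hdot H x y) : ring_scope.
Local Notation ks := (ksection H).
Hypothesis e_ortho : forall i j,
  '[e i, e j] = if i == j then (a i)^-1%:C%C else 0.
Implicit Types (f g : H) (c d : nat -> Cplx R).

Let a_neq0 k : a k != 0. Proof. by rewrite gt_eqF. Qed.

(** The i-th Taylor coefficient, since z^i has squared norm 1/a_i. *)
Definition coef f i : Cplx R := (a i)%:C%C * '[f, e i].
Definition synth c n : H := \sum_(i < n) c i *: e i.
Definition energy c n : R := \sum_(i < n) csq (c i) / a i.

Lemma dot_synth_e c n i :
  '[synth c n, e i] = if (i < n)%N then c i * (a i)^-1%:C%C else 0.
Proof.
rewrite dot_suml; case: ltnP => [ni|ni].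
  rewrite (bigD1 (Ordinal ni)) //= big1 ?addr0 => [|k /eqP kj].
    by rewrite dotZl e_ortho eqxx.
  rewrite dotZl e_ortho ifN ?mulr0 //.
  by apply/eqP => E; apply: kj; apply: val_inj.
rewrite big1 // => k _; rewrite dotZl e_ortho ifN ?mulr0 //.
by rewrite neq_ltn (leq_trans (ltn_ord k) ni).
Qed.

Lemma dot_coef f i : '[f, e i] = coef f i * (a i)^-1%:C%C.
Proof. by rewrite /coef mulrAC -rcM mulfV // mul1r. Qed.

Lemma coef_synth c n i : (i < n)%N -> coef (synth c n) i = c i.
Proof.
by move=> ni; rewrite /coef dot_synth_e ni mulrCA -rcM mulfV // mulr1.
Qed.

Lemma dot_synth f d n :
  '[f, synth d n] = \sum_(i < n) coef f i * (d i)^* * (a i)^-1%:C%C.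
Proof.
rewrite dot_sumr; apply: eq_bigr => i _.
by rewrite dotZr dot_coef mulrA [X in X * _]mulrC.
Qed.

Lemma energyE c n :
  \sum_(i < n) c i * (c i)^* * (a i)^-1%:C%C = (energy c n)%:C%C.
Proof.
rewrite /energy; elim: n => [|n IH]; first by rewrite !big_ord0.
by rewrite !big_ord_recr /= IH mulJ_csq -rcM -rcD.
Qed.

Lemma energy_incr c n : energy c n <= energy c n.+1.
Proof. by rewrite /energy big_ord_recr lerDl divr_ge0 ?csq_ge0 // ltW. Qed.

Lemma nsq_synthB c m n : (m <= n)%N ->
  nsq (synth c n - synth c m) = energy c n - energy c m.
Proof.
move=> mn; have E k : (k <= n)%N ->
    '[synth c n, synth c k] = (energy c k)%:C%C.
  move=> kn; rewrite dot_synth -energyE; apply: eq_bigr => i _.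
  by rewrite coef_synth // (leq_trans (ltn_ord i)).
have E2 k : nsq (synth c k) = energy c k.
  rewrite /nsq dot_synth -[RHS](ReC (energy c k)) -energyE; congr complex.Re.
  by apply: eq_bigr => i _; rewrite coef_synth.
rewrite nsqB !E2 /rdot E // ReC; ring.
Qed.

Lemma nsq_synth_coefB f n :
  nsq (f - synth (coef f) n) = nsq f - energy (coef f) n.
Proof.
have E2 k : nsq (synth (coef f) k) = energy (coef f) k.
  rewrite /nsq dot_synth -[RHS](ReC (energy (coef f) k)) -energyE.
  by congr complex.Re; apply: eq_bigr => i _; rewrite coef_synth.
rewrite nsqB E2 /rdot dot_synth energyE ReC; ring.
Qed.

Lemma energy_le f n : energy (coef f) n <= nsq f.
Proof. by rewrite -subr_ge0 -nsq_synth_coefB nsq_ge0. Qed.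

(** Partial sums of an orthogonal series with bounded energy are Cauchy. *)
Lemma synthesis c (M : R) : (forall n, energy c n <= M) ->
  exists2 f, hcvg (synth c) f & forall i, coef f i = c i.
Proof.
move=> hM; have [l hl _] := nondecr_bounded_cvg (energy_incr c) hM.
have [f hf] : exists f, hcvg (synth c) f.
  apply: hcomplete_nsq => eps eps0.
  have [N hN] := seq_cauchy hl eps0; exists N => m n Nm Nn.
  have := hN m n Nm Nn; have [mn|nm] := leqP m n.
    by rewrite nsqC (nsq_synthB c mn) distrC; apply: le_lt_trans; exact: ler_norm.
  by rewrite (nsq_synthB c (ltnW nm)); apply: le_lt_trans; exact: ler_norm.
exists f => // i; apply: (@ccvg_uniq _ (fun n => coef (synth c (n + i.+1)%N) i)).
  apply: ccvgM (ccvg_cst _) _; have [h1 h2] := hcvg_ccvg (e i) hf.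
  by split; [exact: (seq_shift i.+1 h1)|exact: (seq_shift i.+1 h2)].
apply: ccvg_eq (ccvg_cst (c i)) _ _ => // n.
by rewrite coef_synth // ltn_addl.
Qed.

Lemma coef_ks w i : coef (ks w) i = (a i)%:C%C * (val w)^* ^+ i.
Proof. by rewrite /coef dotC e_monomial rmorphXn. Qed.

Lemma ks_expansion w : hcvg (synth (coef (ks w))) (ks w).
Proof.
have [h _] := K_cvg w w.
rewrite /hcvg; apply: (seq_cvg_eq (seqB (cvg_cst (nsq (ks w))) h)) => [n|]; last first.
  by rewrite /nsq dot_ks subrr.
rewrite nsqC nsq_synth_coefB; congr (_ - _).
rewrite /energy /psum Re_sum; apply: eq_bigr => i _.
rewrite coef_ks csqM csqX csqJ mulJ_csq -rcX -rcM ReC.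
rewrite /csq !partE expr0n addr0 -/(csq _); field; exact: a_neq0.
Qed.

(** Kernel sections are limits of their own monomial expansions, so pairing
    with them turns f into its Taylor series. Completeness of the monomials
    follows: Taylor coefficients determine f. *)
Lemma eval_expansion f w :
  ccvg (fun n => \sum_(i < n) coef f i * val w ^+ i) '[f, ks w].
Proof.
apply: ccvg_eq (hcvg_ccvgr f (ks_expansion w)) _ _ => // n.
rewrite dot_synth; apply: eq_bigr => i _.
rewrite coef_ks rmorphM /= rcJ rmorphXn /= conjCK.
have h : ((a i)%:C%C : Cplx R) * (a i)^-1%:C%C = 1 by rewrite -rcM mulfV.
have -> (x y A B : Cplx R) : x * (A * y) * B = x * y * (A * B) by ring.
by rewrite h mulr1.
Qed.

Lemma coef_inj f g : (forall i, coef f i = coef g i) -> f = g.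
Proof.
move=> h; apply: rkhs_inj => w; apply: ccvg_uniq (eval_expansion f w) _.
apply: ccvg_eq (eval_expansion g w) _ _ => // n.
by apply: eq_bigr => i _; rewrite h.
Qed.

Lemma expansion f : hcvg (synth (coef f)) f.
Proof.
have [g hg gf] := synthesis (energy_le f).
by rewrite (coef_inj gf) in hg.
Qed.

Lemma parseval f g :
  ccvg (fun n => \sum_(i < n) coef f i * (coef g i)^* * (a i)^-1%:C%C) '[f, g].
Proof.
apply: ccvg_eq (hcvg_ccvgr f (expansion g)) _ _ => // n.
by rewrite dot_synth.
Qed.

Lemma coefP (b : Cplx R) f g i :
  coef (b *: f + g) i = b * coef f i + coef g i.
Proof. by rewrite /coef dotDl dotZl mulrDr mulrCA. Qed.

Hypothesis a_incr : forall k, a k <= a k.+1.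

(** Shifting the coefficients does not increase the energy because the weights
    1/a_i decrease, so the shifted series converges in the space. *)
Lemma shift_exists f : exists g : H,
  [/\ coef g 0 = 0, forall i, coef g i.+1 = coef f i
    & forall w, feval H g w = val w * feval H f w].
Proof.
pose c i := if i is i'.+1 then coef f i' else 0.
have [|g hg cg] := @synthesis c (nsq f).
  move=> n; apply: le_trans (energy_le f n).
  case: n => [|n]; first by rewrite /energy !big_ord0.
  apply: le_trans (energy_incr _ _); rewrite /energy big_ord_recl /=.
  rewrite [csq 0](_ : _ = 0) ?mul0r ?add0r; last by rewrite /csq !partE; ring.
  apply: ler_sum => i _; rewrite ler_wpM2l ?csq_ge0 // lef_pV2 ?posrE //.
exists g; split=> [|i|w]; rewrite ?cg //.
rewrite !reproducing.
have [h1 h2] := eval_expansion g w.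
have hS : ccvg (fun n => \sum_(i < n.+1) coef g i * val w ^+ i) '[g, ks w].
  by split; [exact: (seqS h1)|exact: (seqS h2)].
apply: ccvg_uniq hS _.
apply: ccvg_eq (ccvgM (ccvg_cst (val w)) (eval_expansion f w)) _ _ => // n.
rewrite big_ord_recl cg /= mul0r add0r mulr_sumr; apply: eq_bigr => i _.
by rewrite cg /= exprS mulrCA.
Qed.

Lemma mulz_exists : exists T : {linear H -> H},
  [/\ is_mulz T, forall f, coef (T f) 0 = 0
    & forall f i, coef (T f) i.+1 = coef f i].
Proof.
have [T hT] := choice shift_exists.
have lin : linear T.
  move=> b f g; apply: coef_inj => -[|i].
    by rewrite coefP; case: (hT (b *: f + g)) (hT f) (hT g) =>
      -> _ _ [-> _ _] [-> _ _]; rewrite mulr0 addr0.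
  by rewrite coefP; case: (hT (b *: f + g)) (hT f) (hT g) =>
    _ -> _ [_ -> _] [_ -> _]; rewrite coefP.
pose T' := GRing.isLinear.Build _ _ _ _ T lin.
pose T'' : {linear H -> H} := HB.pack T T'.
by exists T''; split=> [f z|f|f i]; case: (hT f).
Qed.
End Expansion.

(** * Square-summable sequences in a Hilbert space *)

Section SquareSummable.
Variables (R : realType) (H : hilbert R).
Local Notation "''[' x , y ]" := (hdot H x y) : ring_scope.

Definition sqsummable (f : nat -> H) : Prop :=
  exists M : R, forall n, \sum_(k < n) nsq (f k) <= M.

Definition l2_pred : {pred nat -> H} := fun f => `[< sqsummable f >].

Lemma l2_submod_closed : submod_closed l2_pred.
Proof.
split=> [|c f g /asboolP [M hM] /asboolP [N hN]]; apply/asboolP.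
  by exists 0 => n; rewrite big1 // => k _; exact: nsq0.
exists (2 * (csq c * M) + 2 * N) => n.
apply: (@le_trans _ _ (2 * (csq c * \sum_(k < n) nsq (f k)) +
    2 * \sum_(k < n) nsq (g k))).
  rewrite !mulr_sumr -big_split; apply: ler_sum => k _ /=.
  by apply: le_trans (nsqD_le _ _) _; rewrite nsqZ.
by rewrite lerD // ler_wpM2l // ler_wpM2l // csq_ge0.
Qed.
HB.instance Definition _ := GRing.isSubmodClosed.Build (Cplx R) (nat -> H)
  l2_pred l2_submod_closed.

Record l2type := L2type { l2val :> nat -> H; l2valP : l2val \in l2_pred }.
HB.instance Definition _ := [isSub for l2val].
HB.instance Definition _ := [Choice of l2type by <:].
HB.instance Definition _ := [SubChoice_isSubLmodule of l2type by <:].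

Lemma l2_eq (f g : l2type) : (forall k, f k = g k) -> f = g.
Proof. by move=> h; apply: val_inj; apply/funext. Qed.

Lemma l2_sqsummable (f : l2type) : sqsummable f.
Proof. exact/asboolP/l2valP. Qed.

Definition l2sum (f g : nat -> H) n : Cplx R := \sum_(k < n) '[f k, g k].

(** Both limits exist, by l2dot_ccvg. *)
Definition l2dot (f g : l2type) : Cplx R :=
  Complex (limn (fun n => complex.Re (l2sum f g n)))
          (limn (fun n => complex.Im (l2sum f g n))).

Lemma l2dot_ccvg (f g : l2type) : ccvg (l2sum f g) (l2dot f g).
Proof.
have [M hM] := l2_sqsummable f; have [N hN] := l2_sqsummable g.
have bnd n : \sum_(k < n) (nsq (f k) + nsq (g k)) <= M + N.
  by rewrite big_split lerD.
have [l1 h1] : exists l : R,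
    (fun n => \sum_(k < n) rdot (f k) (g k)) @ \oo --> l.
  apply: (@abs_summable _ (fun k => rdot (f k) (g k)) (M + N)) => n.
  by apply: le_trans (bnd n); apply: ler_sum => k _; exact: rdot_le.
have [l2 h2] : exists l : R,
    (fun n => \sum_(k < n) rdot (f k) ('i%C *: g k)) @ \oo --> l.
  apply: (@abs_summable _ (fun k => rdot (f k) ('i%C *: g k)) (M + N)) => n.
  apply: le_trans (bnd n); apply: ler_sum => k _.
  apply: le_trans (rdot_le _ _) _; rewrite nsqZ.
  by rewrite /csq /= expr0n expr1n add0r mul1r.
have E1 : (fun n => complex.Re (l2sum f g n)) @ \oo --> l1.
  by apply: (seq_cvg_eq h1) => // n; rewrite /l2sum Re_sum.
have E2 : (fun n => complex.Im (l2sum f g n)) @ \oo --> l2.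
  apply: (seq_cvg_eq h2) => // n; rewrite /l2sum Im_sum.
  by apply: eq_bigr => k _; rewrite Im_rdot.
by split; [have := E1|have := E2] => /cvg_lim /= ->.
Qed.

Lemma l2dot_linear_l (g : l2type) : linear_for *%R (l2dot ^~ g).
Proof.
move=> c f f'; apply: ccvg_uniq (l2dot_ccvg _ _) _.
apply: ccvg_eq (ccvgD (ccvgM (ccvg_cst c) (l2dot_ccvg f g)) (l2dot_ccvg f' g)) _ _ => // n.
rewrite /l2sum mulr_sumr -big_split; apply: eq_bigr => k _ /=.
by rewrite -dotZl -dotDl.
Qed.

Lemma l2dotC (f g : l2type) : l2dot f g = (l2dot g f)^*.
Proof.
apply: ccvg_uniq (l2dot_ccvg _ _) _; apply: ccvg_eq (ccvgJ (l2dot_ccvg g f)) _ _ => // n.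
by rewrite /l2sum rmorph_sum; apply: eq_bigr => k _ /=; rewrite -dotC.
Qed.

Lemma l2dot_linear_r (f : l2type) : linear_for (Num.conj \; *%R) (l2dot f).
Proof.
move=> c g g'; rewrite l2dotC l2dot_linear_l rmorphD rmorphM /=.
by rewrite -!l2dotC.
Qed.

Lemma l2dot_hermitian (f g : l2type) :
  l2dot f g = (-1) ^+ false * Num.conj (l2dot g f).
Proof. by rewrite expr0 mul1r l2dotC. Qed.

Lemma l2sum_nsq (f : nat -> H) n :
  l2sum f f n = (\sum_(k < n) nsq (f k))%:C%C.
Proof.
rewrite /l2sum; elim: n => [|n IH]; first by rewrite !big_ord0.
by rewrite !big_ord_recr /= IH dot_nsq -rcD.
Qed.

Lemma l2dot_real (f : l2type) : l2dot f f = (complex.Re (l2dot f f))%:C%C.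
Proof.
apply: Cplx_eq => //; rewrite ImC; have [_ h] := l2dot_ccvg f f.
apply: seq_uniq h _; apply: (seq_cvg_eq (cvg_cst 0)) => // n.
by rewrite l2sum_nsq ImC.
Qed.

Lemma l2partial_le (f : l2type) n :
  \sum_(k < n) nsq (f k) <= complex.Re (l2dot f f).
Proof.
have [h _] := l2dot_ccvg f f.
have h' : (fun n => \sum_(k < n) nsq (f k)) @ \oo --> complex.Re (l2dot f f).
  by apply: (seq_cvg_eq h) => // m; rewrite l2sum_nsq ReC.
have [|l hl ll] := @nondecr_bounded_cvg _ (fun n => \sum_(k < n) nsq (f k))
    _ _ (svalP (cid (l2_sqsummable f))).
  by move=> m; rewrite big_ord_recr lerDl nsq_ge0.
by rewrite (seq_uniq h' hl); exact: ll.
Qed.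

Lemma l2dot_le (f : l2type) (M : R) :
  (forall n, \sum_(k < n) nsq (f k) <= M) -> complex.Re (l2dot f f) <= M.
Proof.
move=> hM; have [h _] := l2dot_ccvg f f.
by apply: (seq_le h (cvg_cst M)) => n; rewrite l2sum_nsq ReC.
Qed.

Lemma l2coord_le (f : l2type) k : nsq (f k) <= complex.Re (l2dot f f).
Proof.
apply: le_trans (l2partial_le f k.+1); rewrite big_ord_recr lerDr.
by apply: sumr_ge0 => i _; exact: nsq_ge0.
Qed.

Lemma l2dot_gt0 (f : l2type) : f != 0 -> 0 < l2dot f f.
Proof.
move=> f0; rewrite l2dot_real ltcE !partE eqxx /=.
rewrite lt_neqAle (le_trans (nsq_ge0 (f 0%N)) (l2coord_le f 0)) andbT.
apply: contra f0 => /eqP h; apply/eqP; apply: l2_eq => k.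
apply: nsq_eq0; apply/eqP; rewrite eq_le nsq_ge0 andbT h.
exact: l2coord_le.
Qed.

HB.instance Definition _ := @bilinear_isBilinear.Build (Cplx R) l2type l2type
  (Cplx R) *%R (Num.conj \; *%R) l2dot (l2dot_linear_l, l2dot_linear_r).
HB.instance Definition _ := @isHermitianSesquilinear.Build (Cplx R) l2type
  false Num.conj l2dot l2dot_hermitian.
HB.instance Definition _ := @isDotProduct.Build (Cplx R) l2type l2dot l2dot_gt0.
Definition l2inner : inner_product l2type := l2dot.

Lemma hcvg_sum_nsqB (u : nat -> l2type) (v : nat -> H) (x : l2type) p :
  (forall k, hcvg (fun n => u n k) (v k)) ->
  (fun n => \sum_(k < p) nsq (x k - u n k)) @ \oo -->
    \sum_(k < p) nsq (x k - v k).
Proof.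
move=> h; elim: p => [|p IH].
  by apply: (seq_cvg_eq (cvg_cst 0)) => [n|]; rewrite big_ord0.
apply: (seq_cvg_eq (seqD IH (@hcvg_nsq _ _ (fun n => x p - u n p) (x p - v p) _))).
- by apply: (seq_cvg_eq (h p)) => // n; rewrite opprB addrC addrA subrK nsqC.
- by move=> n; rewrite big_ord_recr.
- by rewrite big_ord_recr.
Qed.

(** A Cauchy sequence converges in each coordinate. Letting one index go to
    infinity in the bound on finite sums of coordinates shows that the
    coordinatewise limit is square-summable and is also the limit in norm. *)
Lemma l2_complete : dot_complete l2inner.
Proof.
move=> u hu.
have cau (e : R) : 0 < e -> exists N : nat, forall m n : nat, (N <= m)%N ->
    (N <= n)%N -> complex.Re (l2dot (u m - u n) (u m - u n)) < e.
  move=> e0; have [|N hN] := hu (Num.sqrt e); first by rewrite sqrtr_gt0.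
  by exists N => m n Nm Nn; have := hN m n Nm Nn; rewrite ltr_sqrt.
have hk k : exists w : H, hcvg (fun n => u n k) w.
  apply: hcomplete_nsq => e e0.
  have [N hN] := cau e e0; exists N => m n Nm Nn.
  exact: le_lt_trans (l2coord_le (u m - u n) k) (hN m n Nm Nn).
have [v hv] := choice hk.
have tail (e : R) : 0 < e -> exists N : nat, forall m : nat, (N <= m)%N ->
    forall p, \sum_(k < p) nsq (u m k - v k) <= e.
  move=> e0; have [N hN] := cau e e0; exists N => m Nm p.
  have h := seq_shift N (@hcvg_sum_nsqB u v (u m) p hv).
  apply: (seq_le h (cvg_cst e)) => n; apply: ltW.
  have Nn : (N <= n + N)%N by rewrite leq_addl.
  exact: le_lt_trans (l2partial_le (u m - u (n + N)%N) p) (hN m _ Nm Nn).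
have vl2 : v \in l2_pred.
  have [N hN] := tail 1 ltr01.
  have d : (u N : nat -> H) - v \in l2_pred.
    by apply/asboolP; exists 1 => n; exact: hN.
  have -> : v = (u N : nat -> H) - ((u N : nat -> H) - v).
    by rewrite opprB addrC subrK.
  by apply: rpredB => //; exact: l2valP.
exists (L2type vl2) => e e0; have [|N hN] := tail ((e / 2) ^+ 2).
  by rewrite exprn_gt0 // divr_gt0.
exists N => n Nn; rewrite /dot_norm.
have h : complex.Re (l2inner (u n - L2type vl2) (u n - L2type vl2)) <= (e / 2) ^+ 2.
  by apply: l2dot_le => p; exact: hN.
apply: (@le_lt_trans _ _ (e / 2)); last by lra.
have -> : e / 2 = Num.sqrt ((e / 2) ^+ 2).
  by rewrite sqrtr_sqr ger0_norm // divr_ge0 // ltW.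
exact: ler_wsqrtr.
Qed.

Definition l2 : hilbert R := Hilbert l2_complete.

End SquareSummable.

(** * Operators on square-summable sequences *)

Section BoundedOperators.
Variables (R : realType) (H : hilbert R).

Definition nsq_bounded (M : R) (T : H -> H) : Prop :=
  forall x, nsq (T x) <= M * nsq x.

Definition bounded_adjoints (T S : {linear H -> H}) : Prop :=
  [/\ is_adjoint T S, exists M, nsq_bounded M T
    & exists M, nsq_bounded M S].

Lemma nsq_bounded_bounded_op M (T : {linear H -> H}) :
  nsq_bounded M T -> bounded_op T.
Proof.
move=> h; exists (Num.sqrt `|M|) => x; rewrite /hnorm !hnorm_nsq -sqrtrM //.
apply: ler_wsqrtr; apply: le_trans (h x) _.
by rewrite ler_wpM2r ?nsq_ge0 // ler_norm.
Qed.

Lemma nsq_bounded_comp M N (T S : H -> H) :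
  nsq_bounded M T -> nsq_bounded N S ->
  nsq_bounded (`|M| * N) (T \o S).
Proof.
move=> h1 h2 x; apply: le_trans (h1 _) _ => /=.
rewrite -mulrA; apply: (@le_trans _ _ (`|M| * nsq (S x))).
  by rewrite ler_wpM2r ?nsq_ge0 // ler_norm.
by rewrite ler_wpM2l.
Qed.

Lemma nsq_bounded_add M N (T S : H -> H) :
  nsq_bounded M T -> nsq_bounded N S ->
  nsq_bounded (2 * M + 2 * N) (fun x => T x + S x).
Proof.
move=> h1 h2 x; apply: le_trans (nsqD_le _ _) _.
by rewrite [leRHS]mulrDl -!mulrA lerD // ler_wpM2l.
Qed.

Lemma adjoint_sym (T S : {linear H -> H}) : is_adjoint T S -> is_adjoint S T.
Proof. by move=> h x y; rewrite dotC -h -dotC. Qed.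
End BoundedOperators.

Section SequenceOperators.
Variables (R : realType) (H : hilbert R).
Implicit Types (p q : (nat -> H) -> nat -> H).

Definition realizes (T : {linear l2 H -> l2 H}) p : Prop :=
  forall (f : l2 H), l2val (T f) = p (l2val f).

(** Operators are described by formulas p on arbitrary sequences; this says
    that p and q preserve square-summability and are bounded and adjoint to each
    other. It is stable under sums and composition, so banded operators are
    assembled from shifts and diagonal ones without any further estimate. *)
Definition adjointable p q : Prop :=
  exists T S : {linear l2 H -> l2 H},
    [/\ realizes T p, realizes S q & bounded_adjoints T S].

Lemma nsq_l2_le (f : l2 H) (M : R) :
  (forall n, \sum_(k < n) nsq (l2val f k) <= M) -> nsq f <= M.
Proof. exact: l2dot_le. Qed.

Lemma l2_operator p (M : R) :
  (forall c f g, p (c *: f + g) = c *: p f + p g) ->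
  (forall (f : l2 H) n, \sum_(k < n) nsq (p (l2val f) k) <= M * nsq f) ->
  exists2 T : {linear l2 H -> l2 H}, realizes T p & nsq_bounded M T.
Proof.
move=> plin pM.
have pl2 (f : l2 H) : p (l2val f) \in @l2_pred R H.
  by apply/asboolP; exists (M * nsq f) => n; exact: pM.
pose T (f : l2 H) : l2 H := L2type (pl2 f).
have lin : linear T by move=> c f g; apply: val_inj; exact: plin.
pose T' := GRing.isLinear.Build _ _ _ _ T lin.
pose T'' : {linear l2 H -> l2 H} := HB.pack T T'.
exists T'' => // f; apply: nsq_l2_le => n; exact: pM.
Qed.

Lemma adjointable_sym p q : adjointable p q -> adjointable q p.
Proof.
move=> [T [S [h1 h2 [h3 h4 h5]]]]; exists S, T; split=> //; split=> //.
exact: adjoint_sym.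
Qed.

Lemma adjointable_comp p q p' q' : adjointable p q -> adjointable p' q' ->
  adjointable (p \o p') (q' \o q).
Proof.
move=> [T [S [h1 h2 [h3 [M hM] [N hN]]]]].
move=> [T' [S' [h1' h2' [h3' [M' hM'] [N' hN']]]]].
exists (T \o T'), (S' \o S); split.
- by move=> f /=; rewrite h1 h1'.
- by move=> f /=; rewrite h2' h2.
split; first by move=> x y /=; rewrite h3 h3'.
  by exists (`|M| * M'); exact: nsq_bounded_comp.
by exists (`|N'| * N); exact: nsq_bounded_comp.
Qed.

Lemma adjointable_add p q p' q' : adjointable p q -> adjointable p' q' ->
  adjointable (fun f => p f + p' f) (fun f => q f + q' f).
Proof.
move=> [T [S [h1 h2 [h3 [M hM] [N hN]]]]].
move=> [T' [S' [h1' h2' [h3' [M' hM'] [N' hN']]]]].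
exists (T \+ T'), (S \+ S'); split.
- by move=> f /=; rewrite -h1 -h1'.
- by move=> f /=; rewrite -h2' -h2.
split.
- move=> x y; change (hdot (l2 H) (T x + T' x) y = hdot (l2 H) x (S y + S' y)).
  by rewrite dotDl dotDr h3 h3'.
- by exists (2 * M + 2 * M'); exact: nsq_bounded_add.
by exists (2 * N + 2 * N'); exact: nsq_bounded_add.
Qed.

Lemma adjointable_ext p q p' q' : p =1 p' -> q =1 q' ->
  adjointable p q -> adjointable p' q'.
Proof. by move=> /funext -> /funext ->. Qed.

(** The first alternative allows an index shift between the partial sums of
    the two pairings, as happens for the shifts. *)
Lemma l2_adjoint p q (M N : R) :
  (forall c f g, p (c *: f + g) = c *: p f + p g) ->
  (forall c f g, q (c *: f + g) = c *: q f + q g) ->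
  (forall (f : l2 H) n, \sum_(k < n) nsq (p (l2val f) k) <= M * nsq f) ->
  (forall (f : l2 H) n, \sum_(k < n) nsq (q (l2val f) k) <= N * nsq f) ->
  (forall f g n, l2sum (p f) g n.+1 = l2sum f (q g) n) \/
  (forall f g n, l2sum (p f) g n = l2sum f (q g) n) ->
  adjointable p q.
Proof.
move=> pl ql pM qN pq.
have [T hT cT] := l2_operator pl pM; have [S hS cS] := l2_operator ql qN.
exists T, S; split=> //; split; [|by exists M|by exists N] => f g.
have h1 : ccvg (l2sum (p (l2val f)) (l2val g)) (hdot (l2 H) (T f) g).
  by rewrite -hT; exact: l2dot_ccvg.
have h2 : ccvg (l2sum (l2val f) (q (l2val g))) (hdot (l2 H) f (S g)).
  by rewrite -hS; exact: l2dot_ccvg.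
case: pq => pq.
  apply: ccvg_uniq h2; case: h1 => a b; split.
    by apply: (seq_cvg_eq (seqS a)) => // n; rewrite pq.
  by apply: (seq_cvg_eq (seqS b)) => // n; rewrite pq.
by apply: ccvg_uniq h2; apply: ccvg_eq h1 _ _ => // n; rewrite pq.
Qed.

Lemma l2_partial (f : l2 H) n : \sum_(k < n) nsq (l2val f k) <= nsq f.
Proof. exact: l2partial_le. Qed.

Definition shiftR (f : nat -> H) k : H := if k is k'.+1 then f k' else 0.
Definition shiftL (f : nat -> H) k : H := f k.+1.
Definition diag (w : nat -> R) (f : nat -> H) k : H := (w k)%:C%C *: f k.

Lemma adjointable_shift : adjointable shiftR shiftL.
Proof.
apply: (@l2_adjoint _ _ 1 1).
- by move=> c f g; apply/funext => -[|k] //=; rewrite !fctE /= scaler0 addr0.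
- by [].
- move=> f [|n]; rewrite mul1r; first by rewrite big_ord0 nsq_ge0.
  by rewrite big_ord_recl nsq0 add0r; apply: l2_partial.
- move=> f n; rewrite mul1r; apply: le_trans (l2_partial f n.+1).
  by rewrite big_ord_recl lerDr nsq_ge0.
- by left=> f g n; rewrite /l2sum big_ord_recl dot0l add0r.
Qed.

Lemma adjointable_diag w : (forall k, `|w k| <= 1) ->
  adjointable (diag w) (diag w).
Proof.
move=> hw.
have lin c f g : diag w (c *: f + g) = c *: diag w f + diag w g.
  apply/funext => k; rewrite /diag !fctE scalerDr !scalerA; congr (_ *: _ + _).
  by rewrite mulrC.
have bnd (f : l2 H) n : \sum_(k < n) nsq (diag w (l2val f) k) <= 1 * nsq f.
  rewrite mul1r; apply: le_trans (l2_partial f n); apply: ler_sum => k _.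
  rewrite nsqZ ler_piMl ?nsq_ge0 // /csq !partE expr0n addr0.
  by rewrite -[leLHS]real_normK ?num_real // exprn_ile1.
apply: (@l2_adjoint _ _ 1 1) => //; right=> f g n; apply: eq_bigr => k _.
by rewrite /diag dotZl dotZr rcJ.
Qed.

Lemma adjointable_lift (T S : {linear H -> H}) : bounded_adjoints T S ->
  adjointable (fun f => T \o f) (fun f => S \o f).
Proof.
have lin (U : {linear H -> H}) c (f g : nat -> H) :
    U \o (c *: f + g) = c *: (U \o f) + (U \o g).
  by apply/funext => k /=; rewrite !fctE linearP.
have bnd (U : {linear H -> H}) M : nsq_bounded M U -> forall (f : l2 H) n,
    \sum_(k < n) nsq ((U \o l2val f) k) <= `|M| * nsq f.
  move=> hU f n; apply: (@le_trans _ _ (`|M| * \sum_(k < n) nsq (l2val f k))).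
    rewrite mulr_sumr; apply: ler_sum => k _; apply: le_trans (hU _) _.
    by rewrite ler_wpM2r ?nsq_ge0 // ler_norm.
  by rewrite ler_wpM2l // l2_partial.
move=> [h1 [M hM] [N hN]].
apply: (@l2_adjoint _ _ `|M| `|N|); [exact: lin|exact: lin|exact: bnd|exact: bnd|].
by right=> f g n; apply: eq_bigr => k _; rewrite /= h1.
Qed.

Definition jacobi (A B : nat -> R) (f : nat -> H) k : H :=
  (if k is k'.+1 then (A k')%:C%C *: f k' else 0) +
  (B k)%:C%C *: f k + (A k)%:C%C *: f k.+1.

Lemma adjointable_jacobi A B : (forall k, `|A k| <= 1) ->
  (forall k, `|B k| <= 1) -> adjointable (jacobi A B) (jacobi A B).
Proof.
move=> hA hB.
have hAd := adjointable_diag hA; have hBd := adjointable_diag hB.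
have up := adjointable_comp adjointable_shift hAd.
have down := adjointable_comp hAd (adjointable_sym adjointable_shift).
apply: adjointable_ext (adjointable_add (adjointable_add up hBd) down).
  by move=> f; apply/funext => -[|k].
move=> f; apply/funext => k; rewrite /jacobi !fctE /=.
by rewrite [RHS]addrC addrA [RHS]addrAC; case: k.
Qed.

(** The bilateral shift: the index n >= 0 is stored at position 2n and the index
    -(n+1) at position 2n+1. *)
Definition bilateral (f : nat -> H) k : H :=
  if k is k'.+1 then if odd k then f k.+2 else f k'.-1 else f 1.
Definition bilateralV (f : nat -> H) k : H :=
  if odd k then if k is k'.+3 then f k'.+1 else f 0 else f k.+2.

Lemma bilateralK : cancel bilateral bilateralV.
Proof.
move=> f; apply/funext => -[|[|[|k]]] //; rewrite /bilateralV /bilateral /=.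
by case E: (odd k) => //=; rewrite ?E.
Qed.
Lemma bilateralVK : cancel bilateralV bilateral.
Proof.
move=> f; apply/funext => -[|[|[|k]]] //; rewrite /bilateralV /bilateral /=.
by case E: (odd k) => //=; rewrite ?E.
Qed.

Definition ind (P : pred nat) k : R := (P k)%:R.

(** Up to the single passage from index -1 to index 0, the bilateral shift moves
    even positions up by two and odd positions down by two. *)
Lemma adjointable_bilateral : adjointable bilateral bilateralV.
Proof.
have hi (P : pred nat) : adjointable (diag (ind P)) (diag (ind P)).
  by apply: adjointable_diag => k; rewrite /ind; case: (P k); rewrite ?normr0 ?normr1.
have R2 := adjointable_comp adjointable_shift adjointable_shift.
have L2 := adjointable_sym R2.
have ev := adjointable_comp (hi (fun k => ~~ odd k)) R2.
have od := adjointable_comp (hi odd) L2.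
have z := adjointable_comp (hi (pred1 0%N)) (adjointable_sym adjointable_shift).
have s1 (x : H) : (1%:C%C : Cplx R) *: x = x by rewrite scale1r.
have s0 (x : H) : (0%:C%C : Cplx R) *: x = 0 by rewrite scale0r.
apply: adjointable_ext (adjointable_add (adjointable_add ev od) z).
  move=> f; apply/funext => -[|[|k]]; rewrite !fctE /= /diag /ind /= ?s0 ?s1.
  - by rewrite /= ?scaler0 ?add0r.
  - by rewrite add0r addr0.
  by rewrite addr0; case: (odd k) => /=; rewrite ?s0 ?s1 ?add0r ?addr0.
move=> f; apply/funext => -[|[|k]]; rewrite !fctE /= /diag /ind /shiftL /= ?s0 ?s1.
- by rewrite !addr0.
- by rewrite !add0r.
rewrite /bilateralV /= negbK; case: k => [|k] /=; rewrite ?s0 ?s1 ?addr0 //.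
by case: (odd k) => /=; rewrite ?s0 ?s1 ?add0r ?addr0.
Qed.
End SequenceOperators.

(** * From a moment operator to a normal extension *)

Section NormalExtension.
Variables (R : realType) (a : nat -> R).
Hypothesis a_gt0 : forall k, 0 < a k.
Hypothesis a_disc : disc_summable a.
Hypothesis a_incr : forall k, a k <= a k.+1.
Variable K : disc R -> disc R -> Cplx R.
Hypothesis K_cvg : forall z w, ccvg (psum a (val z * (val w)^*)) (K z w).
Variable H : rkhs K.

Lemma bilateral_comp (L : hilbert R) (Q : {linear L -> L}) (f : nat -> L) :
  bilateral (Q \o f) = Q \o bilateral f.
Proof. by apply/funext => -[|k] //=; rewrite /bilateral; case: ifP. Qed.

(** The bilateral shift W is unitary and commutes with Q acting coordinatewise,
    so W Q and its adjoint Q W^-1 have the same products Q^2. *)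
Lemma normal_bilateral (L : hilbert R) (Q : {linear L -> L}) :
  bounded_adjoints Q Q ->
  exists N : {linear l2 L -> l2 L},
    [/\ realizes N (fun f => bilateral (Q \o f)), bounded_op N & normal_op N].
Proof.
move=> hQ.
have [N [S [hN hS [adj [M hM] _]]]] :=
  adjointable_comp (adjointable_bilateral L) (adjointable_lift hQ).
exists N; split=> //; first exact: nsq_bounded_bounded_op hM.
exists S; split=> // f; apply: val_inj.
change (l2val (N (S f)) = l2val (S (N f))).
by rewrite hN hS hS hN /= !bilateral_comp bilateralVK -bilateral_comp bilateralK.
Qed.

(** The vectors Q^n x0 have the norms of the monomials, and placing Q^n x0 at
    index n of the bilateral sequence space makes them orthogonal. This embeds
    the weighted shift isometrically as a restriction of the normal operator W Q. *)
Lemma subnormal_of_moments (L : hilbert R) (Q : {linear L -> L}) (x0 : L) :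
  bounded_adjoints Q Q -> (forall n, nsq (iter n Q x0) = (a n)^-1) ->
  Mz_subnormal H.
Proof.
move=> hQ hx.
have [e [e_mono e_ortho]] := monomial_basis_exists a_gt0 a_disc K_cvg H.
have [T [T_mulz T0 TS]] := mulz_exists a_gt0 K_cvg e_mono e_ortho a_incr.
have [N [hN N_bd N_normal]] := normal_bilateral hQ.
pose cf := coef a e; pose x n := iter n Q x0.
pose J (f : H) k : L := if odd k then 0 else cf f k./2 *: x k./2.
have nsqJ (f : H) n : \sum_(k < n.*2) nsq (J f k) = energy a (cf f) n.
  elim: n => [|n IH]; first by rewrite /energy !big_ord0.
  rewrite doubleS !big_ord_recr /= IH /energy big_ord_recr /=.
  rewrite /J /= odd_double doubleK nsq0 addr0 nsqZ.
  by rewrite -[X in csq _ * X]/(nsq (iter n Q x0)) hx.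
have Jl2 (f : H) : J f \in @l2_pred R L.
  apply/asboolP; exists (nsq f) => n; apply: le_trans (energy_le a_gt0 e_ortho f n).
  rewrite -nsqJ -addnn big_split_ord /= lerDl.
  by apply: sumr_ge0 => k _; exact: nsq_ge0.
pose j0 (f : H) : l2 L := L2type (Jl2 f).
have j0lin : linear j0.
  move=> c f g; apply: l2_eq => k.
  change (J (c *: f + g) k = c *: J f k + J g k); rewrite /J.
  case: (odd k); first by rewrite scaler0 addr0.
  by rewrite /cf coefP scalerDl scalerA.
pose j' := GRing.isLinear.Build _ _ _ _ j0 j0lin.
pose j : {linear H -> l2 L} := HB.pack j0 j'.
have j_iso (f g : H) : hdot (l2 L) (j f) (j g) = hdot H f g.
  apply: ccvg_uniq (parseval a_gt0 K_cvg e_mono e_ortho f g).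
  have [h1 h2] := l2dot_ccvg (j0 f) (j0 g).
  have E n : l2sum (J f) (J g) n.*2 =
      \sum_(i < n) cf f i * (cf g i)^* * (a i)^-1%:C%C.
    rewrite /l2sum; elim: n => [|n IH]; first by rewrite !big_ord0.
    rewrite doubleS !big_ord_recr /= IH /J /= odd_double doubleK dot0l addr0.
    by rewrite dotZl dotZr dot_nsq -[nsq _]/(nsq (iter n Q x0)) hx mulrA.
  split.
    by apply: (seq_cvg_eq (seq_double h1)) => // n; rewrite -E.
  by apply: (seq_cvg_eq (seq_double h2)) => // n; rewrite -E.
have j_T f : N (j f) = j (T f).
  apply: l2_eq => k; rewrite hN /= /bilateral /J /=.
  case: k => [|k]; first by rewrite /cf T0 scale0r linear0.
  case E: (odd k) => /=; last by rewrite ?E /= ?linear0.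
  case: k E => //= k /negPf E.
  by rewrite E /= linearZ /= /cf TS.
exists T; split=> //; split.
  have [M hM] := N_bd; exists M => f.
  have iso (h : H) : hnorm (j h) = hnorm h.
    by rewrite /hnorm /dot_norm j_iso.
  by rewrite -iso -j_T -(iso f).
by exists (l2 L), j, N.
Qed.
End NormalExtension.

(** * Jacobi matrices with moments 1/(k+b) *)

Section JacobiMoments.
Variables (R : realType) (b : R).
Hypothesis b_gt0 : 0 < b.

(** Up to the factor jac_norm n, this is the integral of x^(k+b-1) P_n over
    [0,1], where P_n is the n-th orthogonal polynomial for the weight x^(b-1)
    with P_n(1) = 1: the falling factorial of k of length n divided by
    (k+b)(k+b+1)...(k+b+n). *)
Fixpoint jac_g (k n : nat) : R :=
  if n is n'.+1 then jac_g k n' * (k%:R - n'%:R) / (k%:R + b + n%:R)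
  else (k%:R + b)^-1.
Definition jac_norm n : R := Num.sqrt (2 * n%:R + b).
(** The off-diagonal recurrence coefficients of these orthogonal polynomials
    after normalization, P_n having squared norm 1/(2n+b). *)
Definition jac_A n : R := n.+1%:R * (n%:R + b) /
  ((2 * n%:R + b + 1) * (jac_norm n * jac_norm n.+1)).
(** The general formula has the factor b-1 in numerator and denominator at n = 0
    and is simplified there. *)
Definition jac_B n : R := if n is n'.+1 then
  (2 * n%:R ^+ 2 + 2 * n%:R * b + b ^+ 2 - b) /
    ((2 * n%:R + b - 1) * (2 * n%:R + b + 1))
  else b / (b + 1).
(** The coordinates of x^k in the orthonormal polynomial basis. *)
Definition jac_h k n : R := jac_norm n * jac_g k n.

Lemma jac_norm2 n : jac_norm n ^+ 2 = 2 * n%:R + b.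
Proof. by rewrite sqr_sqrtr // addr_ge0 ?mulr_ge0 // ltW. Qed.
Lemma jac_norm_gt0 n : 0 < jac_norm n.
Proof. by rewrite sqrtr_gt0 ltr_wpDl // mulr_ge0. Qed.

Lemma jac_gS k n : jac_g k.+1 n.+1 =
  jac_g k n * (k%:R + 1) * (k%:R + b) /
    ((k%:R + b + n%:R + 1) * (k%:R + b + n%:R + 2)).
Proof.
have b0 := b_gt0; have k0 : 0 <= k%:R :> R by rewrite ler0n.
elim: n => [|n IH] /=.
  by rewrite -!natr1; field; do ?[apply/andP; split]; rewrite gt_eqF //; lra.
rewrite -/(jac_g k.+1 n.+1) IH -!natr1.
have n0 : 0 <= n%:R :> R by rewrite ler0n.
by field; do ?[apply/andP; split]; rewrite gt_eqF //; lra.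
Qed.

(** Multiplication by x maps x^k to x^(k+1), and it acts by the Jacobi matrix in
    the orthonormal polynomial basis. Written in closed form this is a rational
    identity, so no integral is needed. The square roots cancel up to one common
    factor. *)
Lemma jac_h_step k n : jac_h k.+1 n =
  (if n is n'.+1 then jac_A n' * jac_h k n' else 0) + jac_B n * jac_h k n
  + jac_A n * jac_h k n.+1.
Proof.
have b0 := b_gt0; have k0 : 0 <= k%:R :> R by rewrite ler0n.
case: n => [|n]; rewrite /jac_h /jac_A /jac_B.
  have s0 := jac_norm_gt0 0; have s1 := jac_norm_gt0 1; have := jac_norm2 0.
  rewrite add0r mulr0 !add0r /= -!natr1 => E.
  have -> : (0 + 1) * b / ((b + 1) * (jac_norm 0 * jac_norm 1)) *
     (jac_norm 1 * ((k%:R + b)^-1 * (k%:R - 0) / (k%:R + b + (0 + 1)))) =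
     jac_norm 0 * (b / ((b + 1) * jac_norm 0 ^+ 2) *
       ((k%:R + b)^-1 * (k%:R - 0) / (k%:R + b + (0 + 1)))).
    by field; do ?[apply/andP; split]; rewrite gt_eqF //; lra.
  rewrite E.
  by field; do ?[apply/andP; split]; rewrite gt_eqF //; lra.
have n0 : 0 <= n%:R :> R by rewrite ler0n.
have s0 := jac_norm_gt0 n; have s1 := jac_norm_gt0 n.+1.
have s2 := jac_norm_gt0 n.+2; have E := jac_norm2 n.+1.
rewrite jac_gS /=; set g := jac_g k n.
rewrite -(natr1 n) in E; rewrite -(natr1 n.+1) -(natr1 n).
set S0 := jac_norm n in s0 *; set S1 := jac_norm n.+1 in s1 E *.
set S2 := jac_norm n.+2 in s2 *.
have -> : (n%:R + 1) * (n%:R + b) / ((2 * n%:R + b + 1) * (S0 * S1)) * (S0 * g) =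
   S1 * ((n%:R + 1) * (n%:R + b) / ((2 * n%:R + b + 1) * S1 ^+ 2) * g).
  by field; do ?[apply/andP; split]; rewrite gt_eqF //; lra.
set G2 := g * _ / _ * _ / _.
have -> : (n%:R + 1 + 1) * (n%:R + 1 + b) /
    ((2 * (n%:R + 1) + b + 1) * (S1 * S2)) * (S2 * G2) =
   S1 * ((n%:R + 1 + 1) * (n%:R + 1 + b) /
    ((2 * (n%:R + 1) + b + 1) * S1 ^+ 2) * G2).
  by field; do ?[apply/andP; split]; rewrite gt_eqF //; lra.
rewrite E /G2.
by field; do ?[apply/andP; split]; rewrite gt_eqF //; lra.
Qed.

Lemma jac_h0 n : jac_h 0 n.+1 = 0.
Proof.
rewrite /jac_h; suff -> : jac_g 0 n.+1 = 0 by rewrite mulr0.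
elim: n => [|n IH] /=; first by rewrite subrr mulr0 mul0r.
by move: IH => /= ->; rewrite !mul0r.
Qed.

Lemma jac_A_le1 n : `|jac_A n| <= 1.
Proof.
have b0 := b_gt0; have n0 : 0 <= n%:R :> R by rewrite ler0n.
have s0 := jac_norm_gt0 n; have s1 := jac_norm_gt0 n.+1.
have D0 : 0 < (2 * n%:R + b + 1) * (jac_norm n * jac_norm n.+1).
  by rewrite !mulr_gt0 //; lra.
have N0 : 0 <= n.+1%:R * (n%:R + b) by rewrite mulr_ge0 // addr_ge0 // ltW.
rewrite ger0_norm; last by rewrite divr_ge0 // ltW.
rewrite ler_pdivrMr // mul1r; apply: ler_pM => //.
- by rewrite addr_ge0 // ltW.
- by rewrite -natr1; lra.
have : jac_norm n <= jac_norm n.+1.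
  by rewrite ler_wsqrtr // lerD2r ler_wpM2l // ler_nat.
have := jac_norm2 n => E h; have : 0 <= jac_norm n * (jac_norm n.+1 - jac_norm n).
  by rewrite mulr_ge0 ?subr_ge0 // ltW.
by rewrite mulrBr -expr2 E; lra.
Qed.

Lemma jac_B_le1 n : `|jac_B n| <= 1.
Proof.
have b0 := b_gt0; case: n => [|n]; rewrite /jac_B.
  rewrite ger0_norm; last by rewrite divr_ge0 // ?addr_ge0 // ltW.
  by rewrite ler_pdivrMr; lra.
rewrite -(natr1 n); set m : R := n%:R; have m0 : 0 <= m by rewrite ler0n.
have D0 : 0 < (2 * (m + 1) + b - 1) * (2 * (m + 1) + b + 1).
  by rewrite mulr_gt0 //; lra.
rewrite ger0_norm.
  rewrite ler_pdivrMr // mul1r.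
  have : 0 <= m * b by rewrite mulr_ge0 // ltW.
  have : 0 <= m * m by rewrite mulr_ge0.
  nra.
rewrite divr_ge0 ?ltW //.
have : 0 <= m * b by rewrite mulr_ge0 // ltW.
have : 0 <= m * m by rewrite mulr_ge0.
have := sqr_ge0 b.
nra.
Qed.
End JacobiMoments.

Section MomentOperator.
Variable R : realType.

Lemma jacobi_selfadjoint (H : hilbert R) (A B : nat -> R) :
  (forall k, `|A k| <= 1) -> (forall k, `|B k| <= 1) ->
  exists T : {linear l2 H -> l2 H},
    realizes T (jacobi A B) /\ bounded_adjoints T T.
Proof.
move=> hA hB; have [T [S [hT hS [adj bT bS]]]] := adjointable_jacobi H hA hB.
exists T; split=> //; split=> // x y.
rewrite adj; congr (hdot _ _ _); apply: val_inj.
by change (l2val (S y) = l2val (T y)); rewrite hS hT.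
Qed.

Lemma jacobi_comp (H : hilbert R) (A B : nat -> R) (T : {linear H -> H}) f :
  jacobi A B (T \o f) = T \o jacobi A B f.
Proof.
apply/funext => k; rewrite /jacobi /= !linearD !linearZ /=; congr (_ + _ + _).
by case: k => [|k]; rewrite ?linear0 // linearZ.
Qed.

Lemma l2_single (H : hilbert R) (v : H) :
  exists s : l2 H, forall k, l2val s k = if k == 0%N then v else 0.
Proof.
have h : (fun k => if k == 0%N then v else 0) \in @l2_pred R H.
  apply/asboolP; exists (nsq v) => -[|n]; first by rewrite big_ord0 nsq_ge0.
  by rewrite big_ord_recl big1 ?addr0 // => i _; rewrite nsq0.
by exists (L2type h).
Qed.

Lemma dot_l2_single (H : hilbert R) (f s : l2 H) :
  (forall k, l2val s k.+1 = 0) ->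
  hdot (l2 H) f s = hdot H (l2val f 0) (l2val s 0).
Proof.
move=> hs; have [h1 h2] := l2dot_ccvg f s.
apply: (@ccvg_uniq _ (fun n => l2sum (l2val f) (l2val s) n.+1)).
  by split; [exact: (seqS h1)|exact: (seqS h2)].
apply: ccvg_eq (ccvg_cst _) _ _ => // n.
by rewrite /l2sum big_ord_recl big1 ?addr0 // => i _; rewrite hs dot0r.
Qed.

Lemma selfadjoint_iter (H : hilbert R) (Q : {linear H -> H}) x n :
  is_adjoint Q Q -> nsq (iter n Q x) = complex.Re (hdot H (iter (n + n) Q x) x).
Proof.
move=> hQ; have E m k : hdot H (iter m Q x) (iter k Q x) =
    hdot H (iter (m + k) Q x) x.
  by elim: k m => [|k IH] m; rewrite ?addn0 //= -hQ -iterS IH addSnnS.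
by rewrite /nsq E.
Qed.

Lemma l2D (H : hilbert R) (f g : l2 H) k :
  l2val (f + g) k = l2val f k + l2val g k.
Proof. by []. Qed.
Lemma l2Z (H : hilbert R) c (f : l2 H) k : l2val (c *: f) k = c *: l2val f k.
Proof. by []. Qed.

(** Tensor products multiply moments: with S_b the Jacobi operator of the
    parameter b, the operator S_b (x) S_c has the moments 1/((k+b)(k+c)) at the
    product vector. The tensor product is realized on double sequences, S_b acting
    on the first index and S_c on the second; any Hilbert space with a vector u
    may carry the entries. Only even moments occur for norms of the iterates,
    whence 2n. *)
Lemma product_moments (H : hilbert R) (u : H) (b c : R) : 0 < b -> 0 < c ->
  exists (L : hilbert R) (Q : {linear L -> L}) (x0 : L),
    bounded_adjoints Q Q /\ forall n, nsq (iter n Q x0) =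
      nsq u / ((2 * n%:R + b) * (2 * n%:R + c)).
Proof.
move=> b0 c0.
have [S [hS saS]] := jacobi_selfadjoint H (jac_A_le1 c0) (jac_B_le1 c0).
have hAd := adjointable_comp (adjointable_jacobi (l2 H) (jac_A_le1 b0) (jac_B_le1 b0))
  (adjointable_lift saS).
have [Q [Q' [hQ hQ' [adj bQ bQ']]]] := hAd.
have saQ : bounded_adjoints Q Q.
  split=> // x y; rewrite adj; congr (hdot _ _ _); apply: val_inj.
  by change (l2val (Q' y) = l2val (Q y)); rewrite hQ hQ' /= jacobi_comp.
have [s1 hs1] := l2_single ((jac_h b 0 0 * jac_h c 0 0)%:C%C *: u).
have [x0 hx0] := l2_single s1.
exists (l2 (l2 H)), Q, x0; split=> // n.
have E k p q : l2val (l2val (iter k Q x0) p) q =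
    (jac_h b k p * jac_h c k q)%:C%C *: u.
  elim: k p q => [|k IH] p q.
    rewrite /= hx0; case: p => [|p] /=; last by rewrite jac_h0 // mul0r scale0r.
    by rewrite hs1; case: q => [|q] //=; rewrite jac_h0 // mulr0 scale0r.
  have IHS p' : l2val (S (l2val (iter k Q x0) p')) q =
      (jac_h b k p' * jac_h c k.+1 q)%:C%C *: u.
    rewrite hS /jacobi !IH !scalerA -!rcM (jac_h_step c0).
    case: q => [|q]; rewrite ?IH ?scalerA -?rcM.
      by rewrite !add0r -scalerDl -rcD; congr (_%:C%C *: _); ring.
    by rewrite -!scalerDl -!rcD; congr (_%:C%C *: _); ring.
  rewrite iterS hQ.
  change (l2val (jacobi (jac_A b) (jac_B b)
    (S \o l2val (iter k Q x0)) p) q = (jac_h b k.+1 p * jac_h c k.+1 q)%:C%C *: u).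
  rewrite /jacobi !l2D !l2Z !IHS.
  case: p => [|p]; rewrite ?l2Z ?IHS ?scalerA -?rcM ?(jac_h_step b0 k).
    by rewrite !add0r -scalerDl -rcD; congr (_%:C%C *: _); ring.
  by rewrite -!scalerDl -!rcD; congr (_%:C%C *: _); ring.
have [adjQ _ _] := saQ; rewrite (selfadjoint_iter _ _ adjQ).
rewrite dot_l2_single; last by move=> k; rewrite hx0.
have x00 : l2val x0 0 = s1 by rewrite hx0.
rewrite x00 dot_l2_single; last by move=> k; rewrite hs1.
rewrite E hs1 /= dotZl dotZr rcJ dot_nsq -!rcM ReC /jac_h /=.
have Eb := jac_norm2 b0 0; have Ec := jac_norm2 c0 0.
set nb := jac_norm b 0 in Eb *; set nc := jac_norm c 0 in Ec *.
rewrite mulr0 add0r in Eb; rewrite mulr0 add0r in Ec.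
have -> : nb * ((n + n)%:R + b)^-1 * (nc * ((n + n)%:R + c)^-1) *
   (nb * (0 + b)^-1 * (nc * (0 + c)^-1) * nsq u) =
   nb ^+ 2 * nc ^+ 2 * (((n + n)%:R + b)^-1 * ((n + n)%:R + c)^-1 *
     b^-1 * c^-1 * nsq u) by rewrite !add0r; ring.
have n0 : 0 <= n%:R :> R by rewrite ler0n.
rewrite Eb Ec natrD.
by field; do ?[apply/andP; split]; rewrite gt_eqF //; lra.
Qed.
End MomentOperator.

(** * Finite differences of moments *)

Section FiniteDifferences.
Variable R : realType.

Fixpoint fdiff (m : nat -> R) (n k : nat) : R :=
  if n is n'.+1 then fdiff m n' k - fdiff m n' k.+1 else m k.

(** With P = N* N, normality gives |N^i x|^2 = <x, P^i x>. The difference of even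
    order 2n at 0 is then <x, (1-P)^(2n) x> = |(1-P)^n x|^2. *)
Lemma fdiff_ge0_normal (H : hilbert R) (N : {linear H -> H}) (x : H) :
  normal_op N -> forall n, 0 <= fdiff (fun i => nsq (iter i N x)) (n + n) 0.
Proof.
move=> [N' [adj com]] n.
pose P (y : H) := N' (N y); pose D (y : H) := y - P y.
have PN i y : N (iter i P y) = iter i P (N y).
  elim: i => [//|i IH] /=.
  by rewrite [N (P _)]com /P; congr (N' (N _)).
have moment i y z : hdot H (iter i N y) (iter i N z) = hdot H y (iter i P z).
  elim: i y z => [//|i IH] y z; by rewrite (iterSr i N y) (iterSr i N z) IH adj -PN.
have Dadj y z : hdot H (D y) z = hdot H y (D z).
  rewrite /D /P dotBl dotBr; congr (_ - _).
  by rewrite -adj dotC -adj -dotC.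
have DB i y z : iter i D (y - z) = iter i D y - iter i D z.
  elim: i => [//|i IH]; rewrite !iterS IH.
  move: (iter i D y) (iter i D z) => A B; rewrite /D.
  have -> : P (A - B) = P A - P B by rewrite /P !linearB.
  by rewrite !opprD !opprK addrACA.
have diff i k : complex.Re (hdot H x (iter i D (iter k P x))) =
    fdiff (fun i => nsq (iter i N x)) i k.
  elim: i k => [|i IH] k; first by rewrite /= /nsq moment.
  rewrite iterSr /= {1}/D -/(iter k.+1 P x) DB dotBr ReD ReN.
  by rewrite IH -[P (iter k P x)]/(iter k.+1 P x) IH.
rewrite -diff /=.
have DD i y z : hdot H y (iter i D z) = hdot H (iter i D y) z.
  by elim: i y => [//|i IH] y; rewrite iterS -Dadj IH -iterSr.
by rewrite iterD DD; exact: nsq_ge0.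
Qed.
End FiniteDifferences.

Section Rotation.
Variable R : realType.
Variables (u v : R).

(** The number k + w with w = u - iv. *)
Definition shiftC (k : nat) : Cplx R := Complex (k%:R + u) (- v).
Definition rising (n k : nat) : Cplx R := \prod_(i < n.+1) shiftC (k + i).
(** The value n! / ((k+w)(k+1+w)...(k+n+w)) of the Euler beta function, which is
    the n-th difference of k |-> 1/(k+w). *)
Definition beta_val (n k : nat) : Cplx R := (n`!)%:R / rising n k.

Lemma risingSr n k : rising n.+1 k = rising n k * shiftC (k + n.+1).
Proof. by rewrite /rising big_ord_recr. Qed.
Lemma risingSl n k : rising n.+1 k = shiftC k * rising n k.+1.
Proof.
rewrite /rising big_ord_recl addn0; congr (_ * _); apply: eq_bigr => i _.
by rewrite /= addSnnS.
Qed.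

Hypothesis v_neq0 : v != 0.

Lemma shiftC_neq0 k : shiftC k != 0.
Proof. by apply/eqP => -[_ /eqP]; rewrite oppr_eq0 (negPf v_neq0). Qed.
Lemma rising_neq0 n k : rising n k != 0.
Proof. by apply/prodf_neq0 => i _; exact: shiftC_neq0. Qed.

Lemma beta_valS n k : beta_val n.+1 k = beta_val n k - beta_val n k.+1.
Proof.
have h1 := shiftC_neq0 k; have h2 := shiftC_neq0 (k + n.+1).
have r1 := rising_neq0 n k; have r2 := rising_neq0 n k.+1.
have E : rising n k * shiftC (k + n.+1) = shiftC k * rising n k.+1.
  by rewrite -risingSr risingSl.
have sd : shiftC (k + n.+1) = shiftC k + n.+1%:R.
  apply: Cplx_eq; rewrite /shiftC !partE /=; last first.
    by rewrite [X in _ + X](_ : _ = 0) ?addr0 // -(rmorph_nat (real_complex R)).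
  rewrite [complex.Re n.+1%:R](_ : _ = n.+1%:R) ?natrD; first by rewrite addrAC.
  by rewrite -(rmorph_nat (real_complex R)).
have e1 : beta_val n k = (n`!)%:R * shiftC (k + n.+1) / rising n.+1 k.
  by rewrite /beta_val risingSr; field; apply/andP.
have e2 : beta_val n k.+1 = (n`!)%:R * shiftC k / rising n.+1 k.
  by rewrite /beta_val risingSl; field; apply/andP.
rewrite e1 e2 -mulrBl -mulrBr sd addrAC subrr add0r.
by rewrite /beta_val factS natrM mulrC [in RHS]mulrC [in RHS](mulrC _%:R).
Qed.

Lemma fdiff_beta c (m : nat -> R) :
  (forall k, m k = c * complex.Im (beta_val 0 k)) ->
  forall n k, fdiff m n k = c * complex.Im (beta_val n k).
Proof.
move=> hm; elim=> [|n IH] k /=; first exact: hm.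
by rewrite !IH beta_valS ImD ImN mulrBr.
Qed.

Lemma Im_inv (z : Cplx R) : complex.Im z^-1 = - complex.Im z / csq z.
Proof. by case: z => a b; rewrite /csq /= mulNr. Qed.

Lemma Im_beta n k :
  complex.Im (beta_val n k) = - complex.Im (rising n k) * (n`!%:R / csq (rising n k)).
Proof.
have -> : beta_val n k = (n`!%:R%:C%C : Cplx R) * (rising n k)^-1.
  by rewrite /beta_val -(rmorph_nat (real_complex R)).
rewrite ImM ImC mul0r addr0 ReC Im_inv; ring.
Qed.
End Rotation.

(** * Rotation past the negative axis *)

Section ArgumentTurns.
Variables (R : realType) (u v : R) (X Y : nat -> R).

(** X n - i Y n is the product of the numbers i+u - iv for i <= n. Its argument
    decreases by about v/n at each step, so by the divergence of the harmonic
    series it passes -pi. Each step is smaller than pi/2, so Y is then negative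
    at two consecutive indices, one of which is even. *)
Lemma argument_turns : 0 < u -> 0 < v -> X 0%N = u -> Y 0%N = v ->
  (forall n, X n.+1 = (n.+1%:R + u) * X n - v * Y n) ->
  (forall n, Y n.+1 = (n.+1%:R + u) * Y n + v * X n) ->
  ~ (forall n, 0 <= Y (n + n)%N).
Proof.
move=> u0 v0 X0 Y0 XS YS Ye.
have c0 (n : nat) : 0 < n.+1%:R + u by rewrite addr_gt0.
have Yge n : 0 <= Y n.
  case: (boolP (odd n)) => [on|en]; last first.
    by have := Ye n./2; rewrite addnn even_halfK.
  (* At an odd index, Y < 0 after an even index with Y >= 0 forces X < 0, so Y is
     still negative at the next, even, index. *)
  have -> : n = (n./2 + n./2).+1 by rewrite addnn -[LHS]odd_double_half on.
  move: n./2 => {on}n; rewrite leNgt; apply/negP => h.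
  have h1 := Ye n; have := Ye n.+1; rewrite addSn addnS YS leNgt => /negP; apply.
  have x0 : v * X (n + n)%N < 0.
    have : 0 <= ((n + n).+1%:R + u) * Y (n + n)%N by rewrite mulr_ge0 // ltW.
    move: h; rewrite YS; lra.
  have x1 : X (n + n).+1 < 0.
    have x2 : X (n + n)%N < 0 by rewrite -(pmulr_rlt0 _ v0).
    have : ((n + n).+1%:R + u) * X (n + n)%N < 0 by rewrite pmulr_rlt0.
    have : 0 <= v * Y (n + n)%N by rewrite mulr_ge0 // ltW.
    rewrite XS; lra.
  have : ((n + n).+2%:R + u) * Y (n + n).+1 < 0 by rewrite pmulr_rlt0.
  have : v * X (n + n).+1 < 0 by rewrite pmulr_rlt0.
  lra.
have Ygt n : 0 < Y n.
  elim: n => [|n IH]; first by rewrite Y0.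
  rewrite lt_neqAle Yge andbT eq_sym; apply/negP => /eqP h.
  have cY : 0 < (n.+1%:R + u) * Y n by rewrite mulr_gt0.
  have x2 : X n < 0 by rewrite -(pmulr_rlt0 _ v0); move: h; rewrite YS; lra.
  have x1 : X n.+1 < 0.
    have : (n.+1%:R + u) * X n < 0 by rewrite pmulr_rlt0.
    have : 0 <= v * Y n by rewrite mulr_ge0 // ltW.
    rewrite XS; lra.
  have := Yge n.+2; rewrite YS h mulr0 add0r leNgt => /negP; apply.
  by rewrite pmulr_rlt0.
(* As Y stays positive, p n is the tangent of the angle measured from a
   direction tilted by e, chosen so that the tangent stays finite from the initial
   angle up to a half turn. It is then bounded while its increments dominate a
   multiple of the harmonic series. *)
pose e := v / (2 * u); have e0 : 0 < e by rewrite divr_gt0 // mulr_gt0.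
pose D n := Y n - e * X n; pose N n := - (X n + e * Y n).
have DS n : D n.+1 = (n.+1%:R + u) * D n - v * N n by rewrite /D /N XS YS; ring.
have NS n : N n.+1 = (n.+1%:R + u) * N n + v * D n by rewrite /D /N XS YS; ring.
have D0 n : 0 < D n.
  elim: n => [|n IH].
    rewrite /D X0 Y0 /e (_ : v / (2 * u) * u = v / 2); first by lra.
    by field; rewrite gt_eqF.
  rewrite ltNge; apply/negP => h.
  have cD : 0 < (n.+1%:R + u) * D n by rewrite mulr_gt0.
  have n0 : 0 < N n by rewrite -(pmulr_rgt0 _ v0); move: h; rewrite DS; lra.
  have x0 : X n < 0.
    have : 0 < e * Y n by rewrite mulr_gt0.
    move: n0; rewrite /N; lra.
  have x1 : X n.+1 < 0.
    have : (n.+1%:R + u) * X n < 0 by rewrite pmulr_rlt0.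
    have : 0 < v * Y n by rewrite mulr_gt0.
    rewrite XS; lra.
  have : e * X n.+1 < 0 by rewrite pmulr_rlt0.
  have := Ygt n.+1; move: h; rewrite /D; lra.
pose p n := N n / D n.
have p_le n : p n <= e^-1.
  rewrite /p ler_pdivrMr // -(ler_pM2l e0) mulrA divff ?gt_eqF // mul1r.
  rewrite /N /D; have : 0 <= e * e * Y n.
    by apply: mulr_ge0 => //; apply: mulr_ge0; exact: ltW.
 
  have := Ygt n; lra.
have pS n : p n.+1 - p n = v * (D n ^+ 2 + N n ^+ 2) / (D n * D n.+1).
  have := D0 n; have := D0 n.+1; rewrite /p NS DS.
  move: (n.+1%:R + u) (D n) (N n) => C d m h1 h2.
  by field; apply/andP; split; rewrite gt_eqF.
have p_ge n : p 0%N <= p n.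
  elim: n => [//|n IH]; apply: le_trans IH _; rewrite -subr_ge0 pS.
  apply: divr_ge0; apply: mulr_ge0;
    [exact: ltW|by rewrite addr_ge0 ?sqr_ge0|exact: ltW|exact: ltW].
pose M := 1 + `|u - v * p 0%N|; have M0 : 0 < M by rewrite ltr_pwDl.
have step n : v / M * harmonic n <= p n.+1 - p n.
  have DM : D n.+1 <= D n * (M * n.+1%:R).
    have -> : D n.+1 = D n * (n.+1%:R + u - v * p n).
      have := D0 n; rewrite DS /p; move: (n.+1%:R + u) (D n) (N n) => C d m h.
      by field; rewrite gt_eqF.
    rewrite ler_wpM2l ?(ltW (D0 n)) //.
    have h1 : v * p 0%N <= v * p n by rewrite ler_wpM2l // ltW.
    have h2 : u - v * p 0%N <= `|u - v * p 0%N| by exact: ler_norm.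
    have h3 : 1 <= n.+1%:R :> R by rewrite ler1n.
    have h4 : 0 <= `|u - v * p 0%N| * (n.+1%:R - 1) by rewrite mulr_ge0 ?subr_ge0.
    rewrite /M; move: h1 h2 h3 h4; set A := `|_|; set B := n.+1%:R; lra.
  have MN : 0 < M * n.+1%:R by rewrite mulr_gt0.
  rewrite pS ler_pdivlMr ?mulr_gt0 //.
  rewrite [leLHS](_ : _ = v * D n * (D n.+1 / (M * n.+1%:R))); last first.
    by rewrite /harmonic /=; field; apply/andP; split; rewrite gt_eqF.
  have h : D n.+1 / (M * n.+1%:R) <= D n by rewrite ler_pdivrMr.
  apply: (@le_trans _ _ (v * D n * D n)).
    by rewrite ler_wpM2l // mulr_ge0 // ltW.
  by rewrite -mulrA ler_wpM2l ?(ltW v0) // -expr2 lerDl sqr_ge0.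
have bnd n : v / M * series harmonic n <= p n - p 0%N.
  elim: n => [|n IH]; first by rewrite /series /= big_geq // mulr0 subrr.
  have := step n; rewrite seriesSr mulrDr; lra.
apply: (@dvg_harmonic R); apply: nondecreasing_is_cvgn.
  by apply/nondecreasing_seqP => n; rewrite seriesSr lerDl /harmonic invr_ge0.
exists ((e^-1 - p 0%N) / (v / M)) => _ [n _ <-].
rewrite ler_pdivlMr ?divr_gt0 // mulrC; apply: le_trans (bnd n) _.
by rewrite lerD2r.
Qed.
End ArgumentTurns.

(** * The two directions *)

Section Necessity.
Variables (R : realType) (a : nat -> R).
Hypothesis a_gt0 : forall k, 0 < a k.
Hypothesis a_disc : disc_summable a.
Variable K : disc R -> disc R -> Cplx R.
Hypothesis K_cvg : forall z w, ccvg (psum a (val z * (val w)^*)) (K z w).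
Variable H : rkhs K.

Lemma subnormal_fdiff_ge0 : Mz_subnormal H ->
  forall n, 0 <= fdiff (fun k => (a k)^-1) (n + n) 0.
Proof.
move=> [T [Tz [_ [L [j [N [j_iso _ Nn jN]]]]]]] n.
have [e [e_mono e_ortho]] := monomial_basis_exists a_gt0 a_disc K_cvg H.
have Te i : iter i T (e 0%N) = e i.
  elim: i => [//|i IH]; rewrite iterS IH; apply: (@monomial_uniq _ _ _ i.+1) => // w.
  by rewrite -reproducing Tz reproducing e_mono exprS.
have jT i : iter i N (j (e 0%N)) = j (e i).
  by rewrite -(Te i); elim: i => [//|i IH]; rewrite !iterS IH jN.
have := fdiff_ge0_normal (j (e 0%N)) Nn n.
congr (0 <= fdiff _ _ _); apply/funext => i.
by rewrite jT /nsq j_iso e_ortho eqxx.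
Qed.

(** Here 1/a_k is a multiple of the imaginary part of 1/(k+u-iv), so the
    differences of even order would all be nonnegative only if the product in
    argument_turns never left the lower half-plane at even indices. *)
Lemma complex_roots_not_subnormal (c u v : R) : 0 < c -> 0 < u -> 0 < v ->
  (forall k, a k = ((k%:R + u) ^+ 2 + v ^+ 2) / c) -> ~ Mz_subnormal H.
Proof.
move=> c0 u0 v0 aE /subnormal_fdiff_ge0 h.
have vn : v != 0 by rewrite gt_eqF.
have m k : (a k)^-1 = c / v * complex.Im (beta_val u v 0 k).
  rewrite Im_beta aE /rising big_ord1 addn0 fact0 /shiftC /csq /=.
  have k0 : 0 <= k%:R :> R by rewrite ler0n.
  have d0 : 0 < (k%:R + u) ^+ 2 + v ^+ 2.
    by rewrite ltr_wpDl ?sqr_ge0 // exprn_gt0.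
  by rewrite sqrrN; field; rewrite !gt_eqF.
apply: (@argument_turns R u v (fun n => complex.Re (rising u v n 0))
  (fun n => - complex.Im (rising u v n 0))) => //.
- by rewrite /rising big_ord1 /= add0r.
- by rewrite /rising big_ord1 /= opprK.
- by move=> n; rewrite risingSr ReM /shiftC /= add0n; ring.
- by move=> n; rewrite risingSr ImM /shiftC /= add0n; ring.
move=> n; have := h n; rewrite (fdiff_beta vn m) Im_beta.
have cv : 0 < c / v by rewrite divr_gt0.
have q0 : 0 < (n + n)`!%:R / csq (rising u v (n + n) 0).
  rewrite divr_gt0 ?ltr0n ?fact_gt0 // lt_neqAle csq_ge0 andbT eq_sym.
  by apply: contra (rising_neq0 u vn (n + n) 0) => /eqP /csq_eq0 ->.
by rewrite pmulr_rge0 // pmulr_lge0.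
Qed.
End Necessity.

Section KernelCoefficients.
Variables (R : realType) (r s t : R).
Hypotheses (hr : 0 < r) (hs : 0 < s) (ht : 0 < t).

Lemma kcoef_gt0 k : 0 < kcoef r s t k.
Proof.
have k0 : 0 <= k%:R :> R by rewrite ler0n.
by rewrite addr_gt0 // divr_gt0 // ?mulr_gt0 // ltr_wpDl.
Qed.

Lemma kcoef_incr k : kcoef r s t k <= kcoef r s t k.+1.
Proof.
have h (x : R) : 0 < x -> k%:R + x <= k.+1%:R + x by rewrite lerD2r ler_nat.
have p (x : R) : 0 < x -> 0 <= k%:R + x by move=> x0; rewrite addr_ge0 // ltW.
apply: lerD; rewrite ler_pM2r ?invr_gt0 ?mulr_gt0 ?h //.
by apply: ler_pM; rewrite ?p ?h.
Qed.

Lemma kcoef_disc_summable : disc_summable (kcoef r s t).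
Proof.
have c0 : 0 <= kcoef r s t 1.
  exact/ltW/kcoef_gt0.
apply: disc_summable_le (disc_summable_quadratic c0) => k.
have k0 : 0 <= k%:R :> R by rewrite ler0n.
have b (x : R) : 0 < x -> k%:R + x <= (1 + x) * k.+1%:R.
  move=> x0; rewrite -(natr1 k); have : 0 <= x * k%:R by rewrite mulr_ge0 // ltW.
  lra.
have p (x : R) : 0 < x -> 0 <= k%:R + x by move=> x0; rewrite addr_ge0 // ltW.
have k1 : k.+1%:R <= k.+1%:R ^+ 2 :> R by rewrite expr2 ler_peMl // ler1n.
rewrite /kcoef [leRHS]mulrDl; apply: lerD.
  rewrite [leRHS]mulrAC ler_pM2r ?invr_gt0 //; apply: le_trans (b r hr) _.
  by rewrite ler_wpM2l // addr_ge0 // ltW.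
rewrite [leRHS]mulrAC ler_pM2r ?invr_gt0 ?mulr_gt0 //.
by rewrite expr2 mulrACA; apply: ler_pM; rewrite ?p ?b.
Qed.

(** The inequality of the theorem says that this quadratic polynomial in k has a
    nonnegative discriminant. *)
Lemma kcoef_quadratic k : kcoef r s t k =
  (k%:R ^+ 2 + (r * s + s * t + t * r) / r * k%:R + 2 * (s * t)) / (s * t).
Proof. by rewrite /kcoef; field; rewrite !gt_eqF. Qed.
End KernelCoefficients.

Theorem theorem2p2 (R : realType) (r s t : R)
    (hr : 0 < r) (hs : 0 < s) (ht : 0 < t)
    (H : rkhs (fun z w : disc R => kernel1 r z w + kernel2 s t z w)) :
  Mz_subnormal H <->
  8 * r ^+ 2 * s * t <= (r * s + s * t + t * r) ^+ 2.
Proof.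
have a_gt0 := kcoef_gt0 hr hs ht.
have a_disc := kcoef_disc_summable hr hs ht.
have K_cvg z w := sum_kernel_cvg z w hr hs ht.
pose b : R := (r * s + s * t + t * r) / r.
have st0 : 0 < s * t by rewrite mulr_gt0.
have b0 : 0 < b by rewrite divr_gt0 // !addr_gt0 // mulr_gt0.
have discE : (8 * r ^+ 2 * s * t <= (r * s + s * t + t * r) ^+ 2) =
    (8 * (s * t) <= b ^+ 2).
  rewrite /b expr_div_n ler_pdivlMr ?exprn_gt0 //.
  by congr (_ <= _); ring.
rewrite discE; split.
- move=> sub; rewrite leNgt; apply/negP => disc0.
  (* The complex roots of the quadratic are -b/2 + iv and -b/2 - iv. *)
  pose v := Num.sqrt (2 * (s * t) - b ^+ 2 / 4).
  have v20 : 0 < 2 * (s * t) - b ^+ 2 / 4 by lra.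
  have v2 : v ^+ 2 = 2 * (s * t) - b ^+ 2 / 4 by rewrite sqr_sqrtr // ltW.
  have v0 : 0 < v by rewrite sqrtr_gt0.
  have u0 : 0 < b / 2 by rewrite divr_gt0.
  apply: (complex_roots_not_subnormal a_gt0 a_disc K_cvg st0 u0 v0 _ sub) => k.
  by rewrite kcoef_quadratic // v2 -/b; congr (_ / _); field.
- move=> disc0.
  (* The real roots of the quadratic are -(b + d)/2 and -(b - d)/2. *)
  pose d := Num.sqrt (b ^+ 2 - 8 * (s * t)).
  have d2 : d ^+ 2 = b ^+ 2 - 8 * (s * t) by rewrite sqr_sqrtr // subr_ge0.
  have d_ge0 : 0 <= d by exact: sqrtr_ge0.
  have db : d < b.
    by rewrite -(@ltr_sqr _ d b) ?nnegrE ?(ltW b0) // d2; lra.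
  have h1 : 0 < b + d by rewrite ltr_wpDr.
  have h2 : 0 < b - d by rewrite subr_gt0.
  have [e [_ e_ortho]] := monomial_basis_exists a_gt0 a_disc K_cvg H.
  (* The constant function 1 has squared norm 1 / kcoef 0; this factor gives it
     squared norm 4 s t. *)
  pose C := Num.sqrt (4 * (s * t) * kcoef r s t 0).
  have C2 : C ^+ 2 = 4 * (s * t) * kcoef r s t 0.
    by rewrite sqr_sqrtr // mulr_ge0 ?(ltW (a_gt0 _)) // mulr_ge0 // ltW.
  have nu : nsq (C%:C%C *: e 0%N) = 4 * (s * t).
    rewrite nsqZ /nsq e_ortho eqxx /csq !partE expr0n addr0 C2.
    by rewrite mulfK // gt_eqF.
  have [L [Q [x0 [saQ hx]]]] := product_moments (C%:C%C *: e 0%N) h1 h2.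
  apply: (subnormal_of_moments a_gt0 a_disc (kcoef_incr hr hs ht) K_cvg H saQ (x0 := x0)).
  move=> n; rewrite hx nu kcoef_quadratic // -/b.
  have n0 : 0 <= n%:R :> R by rewrite ler0n.
  have q0 : 0 < n%:R ^+ 2 + b * n%:R + 2 * (s * t).
    by rewrite ltr_wpDl ?mulr_gt0 // addr_ge0 ?sqr_ge0 // mulr_ge0 // ltW.
  have -> : (2 * n%:R + (b + d)) * (2 * n%:R + (b - d)) =
      4 * (n%:R ^+ 2 + b * n%:R + 2 * (s * t)).
    by move: d2; lra.
  by move: q0; set q := _ + _ => q0; field; rewrite !gt_eqF.
Qed.
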